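(* Let $S^1,S^2$ be finite sets, $r>0$, and let $H:\Delta(S^1)\times\Delta(S^2)\times\mathbf R^{|S^1|+|S^2|}\to\mathbf R$ be a map for which there is a constant $C$ with $$|H(p,q)-H(p,q')|\le C|q-q'|\qquad\forall p\in\Delta(S^1)\times\Delta(S^2),\ q,q'\in\mathbf R^{|S^1|+|S^2|},$$ $$|H(p,q)-H(p',q)|\le C|p-p'|(|q|+1)\qquad\forall p,p'\in\Delta(S^1)\times\Delta(S^2),\ q\in\mathbf R^{|S^1|+|S^2|}.$$ Let $w_1$ be a continuous viscosity subsolution and $w_2$ a continuous viscosity supersolution of the Hamilton–Jacobi equation given by the pair of inequalities, in $\Delta(S^1)\times\Delta(S^2)$, $$\max\left\{\min\left\{rw+H(p^1,p^2,Dw);-\lambda_{\max}(p^1,D^2_{11}w)\right\};-\lambda_{\min}(p^2,D^2_{22}w)\right\}\le0,$$ $$\min\left\{\max\left\{rw+H(p^1,p^2,Dw);-\lambda_{\min}(p^2,D^2_{22}w)\right\};-\lambda_{\max}(p^1,D^2_{11}w)\right\}\ge0.$$ Then $w_1\le w_2$ in $\Delta(S^1)\times\Delta(S^2)$.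
   Context: For a finite set $X$, $\Delta(X)\subset\mathbf R^{|X|}$ is the set of probability distributions on $X$, and for $p\in\Delta(X)$, $T_{\Delta(X)}(p):=\{z\in\mathbf R^{|X|}:\exists\varepsilon>0,\ p\pm\varepsilon z\in\Delta(X)\}$. For symmetric matrices $M$ of the appropriate size, $\lambda_{\max}(p^1,M):=\sup\{\langle Mz,z\rangle/|z|^2:z\in T_{\Delta(S^1)}(p^1)\setminus\{0\}\}$ ($=-\infty$ if $T_{\Delta(S^1)}(p^1)=\{0\}$) and $\lambda_{\min}(p^2,M):=\inf\{\langle Mz,z\rangle/|z|^2:z\in T_{\Delta(S^2)}(p^2)\setminus\{0\}\}$ ($=+\infty$ if $T_{\Delta(S^2)}(p^2)=\{0\}$). $D\phi=(D_1\phi,D_2\phi)$ is the full gradient with respect to $(p^1,p^2)$ and $D^2_{ii}\phi$ the second derivative with respect to $p^i$. A map $w:\Delta(S^1)\times\Delta(S^2)\to\mathbf R$ is a viscosity subsolution if it is upper semicontinuous and, for any smooth $\phi:\mathbf R^{|S^1|+|S^2|}\to\mathbf R$ such that $w-\phi$ has a local maximum on $\Delta(S^1)\times\Delta(S^2)$ at $(p^1,p^2)$, one has, at $(p^1,p^2)$, $\max\{\min\{rw+H(p^1,p^2,D\phi);-\lambda_{\max}(p^1,D^2_{11}\phi)\};-\lambda_{\min}(p^2,D^2_{22}\phi)\}\le0$. It is a viscosity supersolution if it is lower semicontinuous and, for any smooth $\phi$ such that $w-\phi$ has a local minimum on $\Delta(S^1)\times\Delta(S^2)$ at $(p^1,p^2)$,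 one has, at $(p^1,p^2)$, $\min\{\max\{rw+H(p^1,p^2,D\phi);-\lambda_{\min}(p^2,D^2_{22}\phi)\};-\lambda_{\max}(p^1,D^2_{11}\phi)\}\ge0$. *)

(* Defs.v *)
From HB Require Import structures.
From mathcomp Require Import all_boot all_order all_algebra.
From mathcomp Require Import all_classical all_reals all_analysis.
Set Implicit Arguments.
Unset Strict Implicit.
Unset Printing Implicit Defensive.
Import Order.TTheory GRing.Theory Num.Theory.
Import numFieldNormedType.Exports.
Local Open Scope classical_set_scope.
Local Open Scope ring_scope.

Section euclidean.
Context {R : realType} {n : nat}.
Implicit Types u v p z : 'rV[R]_n.

Definition dot u v : R := \sum_i u 0 i * v 0 i.

(* The library's norm on row vectors is the sup norm; it is used below only
   through the topology it defines. *)
Definition enorm u : R := Num.sqrt (dot u u).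

Definition simplex : set 'rV[R]_n :=
  [set p | (forall i, 0 <= p 0 i) /\ \sum_i p 0 i = 1].

Definition tangent p : set 'rV[R]_n :=
  [set z | exists2 e : R, 0 < e & simplex (p + e *: z) /\ simplex (p - e *: z)].

(* <Mz, z> / |z|^2, where the product Mz reads z *m M^T on row vectors. *)
Definition rayleigh (M : 'M[R]_n) z : R := dot (z *m M^T) z / enorm z ^+ 2.

(* The supremum (infimum) of the empty set is -oo (+oo) in \bar R. *)
Definition lambda_max p (M : 'M[R]_n) : \bar R :=
  ereal_sup [set (rayleigh M z)%:E | z in tangent p `\ 0].

Definition lambda_min p (M : 'M[R]_n) : \bar R :=
  ereal_inf [set (rayleigh M z)%:E | z in tangent p `\ 0].

Fixpoint Ck (k : nat) (f : 'rV[R]_n -> R) : Prop :=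
  if k is k'.+1 then
    (forall x, differentiable f x) /\ (forall v, Ck k' (fun x => 'D_v f x))
  else continuous f.

Definition smooth (f : 'rV[R]_n -> R) : Prop := forall k, Ck k f.

Definition partial (i : 'I_n) (f : 'rV[R]_n -> R) : 'rV[R]_n -> R :=
  fun x => 'D_(delta_mx 0 i) f x.

Definition gradient (f : 'rV[R]_n -> R) (x : 'rV[R]_n) : 'rV[R]_n :=
  \row_i partial i f x.

Definition hessian (f : 'rV[R]_n -> R) (x : 'rV[R]_n) : 'M[R]_n :=
  \matrix_(i, j) partial i (partial j f) x.

Definition local_max_on (D : set 'rV[R]_n) (f : 'rV[R]_n -> R) p : Prop :=
  D p /\ \forall x \near within D (nbhs p), f x <= f p.

Definition local_min_on (D : set 'rV[R]_n) (f : 'rV[R]_n -> R) p : Prop :=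
  D p /\ \forall x \near within D (nbhs p), f p <= f x.

(* [subspace D] carries the topology in which semicontinuity at the points of
   [D] is relative to [D], and is automatic at all other points. *)
Definition lsc_on (D : set 'rV[R]_n) (f : 'rV[R]_n -> R) : Prop :=
  @lower_semicontinuous (subspace D) R (fun x => (f x)%:E).

Definition usc_on (D : set 'rV[R]_n) (f : 'rV[R]_n -> R) : Prop :=
  lsc_on D (fun x => - f x).

End euclidean.

(* A point (p1, p2) of the product of the simplices is the concatenated row
   vector [row_mx p1 p2]; the coordinates of R^|S| are numbered by the
   enumeration of S. A map on the product of the simplices is a function on the
   whole space whose values outside [Delta2] are irrelevant. *)
Section viscosity.
Context {R : realType} {S1 S2 : finType}.
Local Notation E := 'rV[R]_(#|S1| + #|S2|).

Definition Delta2 : set E :=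
  [set p | simplex (lsubmx p) /\ simplex (rsubmx p)].

Definition hess11 (phi : E -> R) (p : E) : 'M[R]_#|S1| :=
  ulsubmx (hessian phi p).

Definition hess22 (phi : E -> R) (p : E) : 'M[R]_#|S2| :=
  drsubmx (hessian phi p).

Variables (r : R) (H : E -> E -> R).

Local Open Scope ereal_scope.

Definition viscosity_subsolution (w : E -> R) : Prop :=
  usc_on Delta2 w /\
  forall (phi : E -> R) (p : E), smooth phi ->
    local_max_on Delta2 (fun x => w x - phi x)%R p ->
    maxe (mine (r * w p + H p (gradient phi p))%:E
               (- lambda_max (lsubmx p) (hess11 phi p)))
         (- lambda_min (rsubmx p) (hess22 phi p)) <= 0.

Definition viscosity_supersolution (w : E -> R) : Prop :=
  lsc_on Delta2 w /\
  forall (phi : E -> R) (p : E), smooth phi ->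
    local_min_on Delta2 (fun x => w x - phi x)%R p ->
    0 <= mine (maxe (r * w p + H p (gradient phi p))%:E
                    (- lambda_min (rsubmx p) (hess22 phi p)))
              (- lambda_max (lsubmx p) (hess11 phi p)).

End viscosity.
Arguments Delta2 : clear implicits.

(* Main.v *)
(* Doubling of variables with a coupling that, at a maximum point (p, q), leaves
   p2 and q1 in the interior of the simplices. Quadratic test functions show that
   w2 is concave in its first and w1 convex in its second variable. At an
   interior point q1, the concave function w2(., q2) is touched from below by a
   quadratic, hence lies below its tangent there. Moving p1 and q1 together then
   gives a test function for w1 at p that is strictly concave in p1 and has the
   gradient of the coupling, so the Hamiltonian inequality must hold for w1 at p;
   symmetrically it holds for w2 at q. No Jensen-Ishii lemma is needed. *)

(* The Hamiltonian inequality for [w1] is one arm of a minimum: it can be extracted only from a test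
   function with [lambda_max] negative, while the usual penalty |p - q|^2 is convex in p1; likewise
   for [w2] in q2. Small [eps] terms supply the strict sign. Interior points matter because at the
   boundary of a simplex the eigenvalue conditions see only directions along the face, and touching
   from one side does not determine the slope of a concave function. The shifted coupling has a
   price: p and q may stay apart by an amount of order [eta], and the gradients on the two sides
   differ by factors 1 - eta. With [delta = eta ^+ 2] and gaps at most [k * eta], the gradients are
   of order k / eta, so both their mismatch and the product of distance and gradient are of order k,
   up to terms in [eps] and [eta]. The number [k] is fixed before [eta], hence all errors can be
   made small. *)
Require Import Defs.
From HB Require Import structures.
From mathcomp Require Import all_boot all_order all_algebra.
From mathcomp Require Import all_classical all_reals all_analysis.
From mathcomp Require Import ring lra.
Set Implicit Arguments.
Unset Strict Implicit.
Unset Printing Implicit Defensive.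
Import Order.TTheory GRing.Theory Num.Theory.
Import numFieldNormedType.Exports.
Local Open Scope classical_set_scope.
Local Open Scope ring_scope.

(** * Euclidean inner product and norm *)

Section dot_product.
Context {R : realType}.

Lemma dotC n (u v : 'rV[R]_n) : dot u v = dot v u.
Proof. by apply: eq_bigr => i _; rewrite mulrC. Qed.

Lemma dotDl n (u v w : 'rV[R]_n) : dot (u + v) w = dot u w + dot v w.
Proof. by rewrite -big_split; apply: eq_bigr => i _; rewrite mxE mulrDl. Qed.

Lemma dotDr n (u v w : 'rV[R]_n) : dot w (u + v) = dot w u + dot w v.
Proof. by rewrite dotC dotDl !(dotC w). Qed.

Lemma dotZl n (a : R) (u v : 'rV[R]_n) : dot (a *: u) v = a * dot u v.
Proof. by rewrite mulr_sumr; apply: eq_bigr => i _; rewrite mxE mulrA. Qed.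

Lemma dotZr n (a : R) (u v : 'rV[R]_n) : dot u (a *: v) = a * dot u v.
Proof. by rewrite dotC dotZl dotC. Qed.

Lemma dotNl n (u v : 'rV[R]_n) : dot (- u) v = - dot u v.
Proof. by rewrite -scaleN1r dotZl mulN1r. Qed.

Lemma dotNr n (u v : 'rV[R]_n) : dot u (- v) = - dot u v.
Proof. by rewrite dotC dotNl dotC. Qed.

Lemma dot0l n (u : 'rV[R]_n) : dot 0 u = 0.
Proof. by rewrite -(scale0r (0 : 'rV[R]_n)) dotZl mul0r. Qed.

Lemma dot0r n (u : 'rV[R]_n) : dot u 0 = 0.
Proof. by rewrite dotC dot0l. Qed.

Definition dotE := (dotDl, dotDr, dotNl, dotNr, dotZl, dotZr).

Lemma dot_mulmx n (M : 'M[R]_n) (u v : 'rV[R]_n) :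
  dot (u *m M) v = dot u (v *m M^T).
Proof.
have dotM (x y : 'rV[R]_n) : dot x y = (x *m y^T) 0 0.
  by rewrite !mxE; apply: eq_bigr => i _; rewrite mxE.
by rewrite !dotM trmx_mul trmxK mulmxA.
Qed.

Lemma dot_delta n (u : 'rV[R]_n) i : dot u (delta_mx 0 i) = u 0 i.
Proof.
rewrite /dot (bigD1 i)//= big1 ?addr0 ?mxE ?eqxx ?mulr1// => j ji.
by rewrite mxE (negPf ji) andbF mulr0.
Qed.

Lemma dot_outer n (d u : 'rV[R]_n) : u *m (d^T *m d) = dot u d *: d.
Proof.
rewrite mulmxA [u *m d^T]mx11_scalar mul_scalar_mx mxE; congr (_ *: _).
by apply: eq_bigr => i _; rewrite mxE.
Qed.

Lemma dot_row_mx n1 n2 (u1 v1 : 'rV[R]_n1) (u2 v2 : 'rV[R]_n2) :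
  dot (row_mx u1 u2) (row_mx v1 v2) = dot u1 v1 + dot u2 v2.
Proof.
rewrite /dot big_split_ord /=; congr (_ + _); apply: eq_bigr => i _.
  by rewrite !row_mxEl.
by rewrite !row_mxEr.
Qed.

Lemma dot_ge0 n (u : 'rV[R]_n) : 0 <= dot u u.
Proof. by apply: sumr_ge0 => i _; rewrite -expr2 sqr_ge0. Qed.

Lemma sqr_coord_le_dot n (u : 'rV[R]_n) i : u 0 i ^+ 2 <= dot u u.
Proof.
rewrite /dot (bigD1 i) //= expr2 lerDl.
by apply: sumr_ge0 => j _; rewrite -expr2 sqr_ge0.
Qed.

Lemma dot_eq0 n (u : 'rV[R]_n) : (dot u u == 0) = (u == 0).
Proof.
apply/eqP/eqP => [u0|->]; last by rewrite dot0l.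
apply/rowP => i; rewrite mxE; apply/eqP; rewrite -sqrf_eq0 eq_le sqr_ge0.
by rewrite -u0 sqr_coord_le_dot.
Qed.

Lemma dot_gt0 n (u : 'rV[R]_n) : u != 0 -> 0 < dot u u.
Proof. by rewrite lt_def dot_ge0 dot_eq0 => ->. Qed.

Lemma enorm_ge0 n (u : 'rV[R]_n) : 0 <= enorm u.
Proof. exact: sqrtr_ge0. Qed.

Lemma enorm_sqr n (u : 'rV[R]_n) : enorm u ^+ 2 = dot u u.
Proof. by rewrite sqr_sqrtr ?dot_ge0. Qed.

Lemma coord_le_enorm n (u : 'rV[R]_n) i : `|u 0 i| <= enorm u.
Proof. by rewrite -sqrtr_sqr ler_sqrt ?dot_ge0// sqr_coord_le_dot. Qed.

(** The bridge from Euclidean estimates to the topology, whose norm is the sup norm. *)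
Lemma norm_le_enorm n (u : 'rV[R]_n) : `|u| <= enorm u.
Proof.
rewrite [X in X <= _]mx_normrE; apply/bigmax_leP; split => [|[i j] _ /=].
  exact: enorm_ge0.
by rewrite (ord1 i) coord_le_enorm.
Qed.

Lemma enorm_le n (u : 'rV[R]_n) (a : R) : 0 <= a -> dot u u <= a ^+ 2 ->
  enorm u <= a.
Proof.
by move=> a0 ua; rewrite -(ler_pXn2r (n:=2))// ?nnegrE ?enorm_ge0// enorm_sqr.
Qed.

Lemma dot_le_enorm n (u v : 'rV[R]_n) : dot u v <= enorm u * enorm v.
Proof.
have [->|u0] := eqVneq u 0; first by rewrite dot0l mulr_ge0 ?enorm_ge0.
have [->|v0] := eqVneq v 0; first by rewrite dot0r mulr_ge0 ?enorm_ge0.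
have pos x : x != 0 -> 0 < enorm x :> R by move=> x0; rewrite sqrtr_gt0 dot_gt0.
(* This square expands to 2 |u| |v| (|u| |v| - u.v), which gives Cauchy-Schwarz. *)
have := dot_ge0 (enorm v *: u - enorm u *: v).
rewrite !dotE -!enorm_sqr (dotC v u).
move=> h; have : 0 <= 2 * (enorm u * enorm v) * (enorm u * enorm v - dot u v).
  by lra.
by rewrite pmulr_rge0 ?subr_ge0// !mulr_gt0 ?pos.
Qed.

Lemma enormD n (u v : 'rV[R]_n) : enorm (u + v) <= enorm u + enorm v.
Proof.
apply: enorm_le; first by rewrite addr_ge0 ?enorm_ge0.
rewrite !dotE (dotC v u) sqrrD -!enorm_sqr.
by have := dot_le_enorm u v; lra.
Qed.

Lemma enormZ n (a : R) (u : 'rV[R]_n) : enorm (a *: u) = `|a| * enorm u.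
Proof.
by rewrite /enorm dotZl dotZr mulrA -expr2 sqrtrM ?sqr_ge0// sqrtr_sqr.
Qed.

Lemma enormN n (u : 'rV[R]_n) : enorm (- u) = enorm u.
Proof. by rewrite /enorm dotNl dotNr opprK. Qed.

Lemma enorm_row_mx n1 n2 (u : 'rV[R]_n1) (v : 'rV[R]_n2) :
  enorm (row_mx u v) <= enorm u + enorm v.
Proof.
apply: enorm_le; first by rewrite addr_ge0 ?enorm_ge0.
rewrite dot_row_mx sqrrD -!enorm_sqr.
by have := mulr_ge0 (enorm_ge0 u) (enorm_ge0 v); lra.
Qed.

End dot_product.

(** * Quadratic test functions and their derivatives *)

Section quadratic_test_functions.
Context {R : realType} {n : nat}.
Implicit Types (x a g v : 'rV[R]_n) (M : 'M[R]_n).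

(** For symmetric [M] this family is closed under directional derivatives, which are the affine
    members [M = 0]; smoothness of every order is then an induction. *)
Definition quad (c : R) a g M x : R :=
  c + dot g (x - a) + dot ((x - a) *m M) (x - a) / 2.

Lemma differentiable_dot (f g : 'rV[R]_n -> 'rV[R]_n) x :
  (forall i, differentiable (fun y => f y 0 i : R) x) ->
  (forall i, differentiable (fun y => g y 0 i : R) x) ->
  differentiable (fun y => dot (f y) (g y)) x.
Proof.
move=> df dg.
have -> : (fun y => dot (f y) (g y)) =
    \sum_(i < n) (fun y => f y 0 i * g y 0 i) by rewrite fct_sumE.
by apply: differentiable_sum => i; apply: differentiableM.
Qed.

Lemma differentiable_quad c a g M x : differentiable (quad c a g M) x.
Proof.
have dx i : differentiable (fun y : 'rV[R]_n => (y - a) 0 i) x.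
  rewrite (_ : (fun _ => _) = (fun y : 'rV[R]_n => y 0 i) - cst (a 0 i)).
    apply: differentiableB; last exact: differentiable_cst.
    exact: differentiable_coord.
  by apply/funext => y; rewrite !mxE.
have dxM i : differentiable (fun y : 'rV[R]_n => ((y - a) *m M) 0 i) x.
  rewrite (_ : (fun _ => _) = (fun y : 'rV[R]_n => dot (y - a) (col i M)^T)).
    by apply: differentiable_dot => // j; exact: differentiable_cst.
  by apply/funext => y; rewrite mxE; apply: eq_bigr => j _; rewrite !mxE.
rewrite (_ : quad c a g M = cst c + (fun y => dot g (y - a)) +
  (fun y => dot ((y - a) *m M) (y - a)) * cst 2^-1); last exact/funext.
apply: differentiableD; last first.
  apply: differentiableM; last exact: differentiable_cst.
  exact: differentiable_dot.
apply: differentiableD; first exact: differentiable_cst.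
by apply: differentiable_dot => // i; exact: differentiable_cst.
Qed.

Lemma quad_shift c a g M x v : M^T = M ->
  quad c a g M (v + x) = quad c a g M x
    + quad (dot g v) a (v *m M) 0 x + dot (v *m M) v / 2.
Proof.
move=> MT; rewrite /quad mulmx0 dot0l -(addrA v x).
move: (x - a) => y; rewrite !(mulmxDl, dotDl, dotDr).
have -> : dot (y *m M) v = dot (v *m M) y.
  by rewrite dot_mulmx MT dotC.
by field.
Qed.

Lemma derive_quad c a g M v x : M^T = M ->
  'D_v (quad c a g M) x = quad (dot g v) a (v *m M) 0 x.
Proof.
move=> MT; set L := RHS; pose Q := dot (v *m M) v / 2.
(* The difference quotient is exactly affine in [h], so its limit is read off at 0. *)
have slopeE (h : R) : h != 0 -> h^-1 *:
    ((quad c a g M \o shift x) (h *: v) - quad c a g M x) = L + h * Q.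
  move=> h0; rewrite /= quad_shift// /L /Q /quad mulmx0 dot0l.
  by rewrite -!scalemxAl !dotE /GRing.scale/=; field.
apply: cvg_lim => //.
have : (fun h : R => L + h * Q) h @[h --> 0^'] --> L + 0 * Q.
  apply: cvg_within_filter; apply: cvgD; first exact: cvg_cst.
  by apply: cvgM; [exact: cvg_id|exact: cvg_cst].
rewrite mul0r addr0; apply: cvg_trans; apply: near_eq_cvg.
near=> h; rewrite slopeE//; near: h; exact: nbhs_dnbhs_neq.
Unshelve. all: by end_near. Qed.

Lemma smooth_quad c a g M : M^T = M -> smooth (quad c a g M).
Proof.
move=> MT k; elim: k c g M MT => [|k IH] c g M MT /=.
  by move=> x; exact/differentiable_continuous/differentiable_quad.
split=> [x|v]; first exact: differentiable_quad.
rewrite (_ : (fun _ => _) = quad (dot g v) a (v *m M) 0).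
  by apply: IH; rewrite trmx0.
by apply/funext => x; rewrite derive_quad.
Qed.

Lemma gradient_quad c a g M x : M^T = M ->
  gradient (quad c a g M) x = g + (x - a) *m M.
Proof.
move=> MT; apply/rowP => i; rewrite !mxE /partial derive_quad//.
rewrite /quad mulmx0 dot0l mul0r addr0 dot_delta dot_mulmx MT dotC dot_delta.
by rewrite mxE.
Qed.

Lemma hessian_quad c a g M x : M^T = M -> hessian (quad c a g M) x = M.
Proof.
move=> MT; apply/matrixP => i j; rewrite !mxE.
rewrite (_ : partial j _ = quad (dot g (delta_mx 0 j)) a (delta_mx 0 j *m M) 0).
  rewrite /partial derive_quad ?trmx0// mulmx0 -rowE /quad dot_delta mulmx0.
  by rewrite !dot0l mul0r !addr0 mxE -{1}MT mxE.
by apply/funext => y; exact: derive_quad.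
Qed.

End quadratic_test_functions.

(** * Relative continuity, compactness and local extrema *)

Section semicontinuity_and_extrema.
Context {R : realType} {n : nat}.
Implicit Types (D : set 'rV[R]_n) (f w : 'rV[R]_n -> R).

Lemma within_continuous_dist D w x e : {within D, continuous w} -> D x ->
  0 < e -> exists2 rho : R, 0 < rho &
    forall y, D y -> `|y - x| < rho -> `|w y - w x| < e.
Proof.
move=> /subspace_continuousP cw Dx e0.
have /cvgrPdist_lt/(_ _ e0) := cw x Dx.
rewrite near_withinE => /nbhs_ballP[rho /= rho0 xrho].
exists rho => // y Dy yx; rewrite distrC; apply: xrho => //.
by rewrite -ball_normE /= distrC.
Qed.

Lemma within_uniformly_continuous D w e : compact D ->
  {within D, continuous w} -> 0 < e ->
  exists2 rho : R, 0 < rho &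
    forall x y, D x -> D y -> `|x - y| < rho -> `|w x - w y| < e.
Proof.
move=> cD cw e0.
pose P (rho : R) x := forall y, D x -> D y -> `|x - y| < rho ->
  `|w x - w y| < e.
(* Heine-Cantor: half the radius of continuity at [x] works on a neighbourhood of [x], and
   compactness makes one radius serve all of [D]. *)
have /compact_near_coveringP/(_ _ (0 : R)^'+ P) := cD.
move=> cov; have {cov} : \forall rho \near 0^'+, D `<=` P rho.
  apply: cov => x Dx.
  have [rho rho0 xrho] := within_continuous_dist cw Dx (divr_gt0 e0 (ltr0n _ 2)).
  have rho2 : 0 < rho / 2 by rewrite divr_gt0.
  exists (ball x (rho / 2), [set d : R | d < rho / 2]) => /=.
    split; first exact: nbhsx_ballx.
    exact: nbhs_right_lt.
  move=> [y d] /= [xy d1] z Dy Dz yz.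
  have xy' : `|y - x| < rho / 2 by rewrite distrC; rewrite -ball_normE in xy.
  have zx : `|z - x| < rho.
    rewrite (le_lt_trans (ler_distD y _ _))// (splitr rho) ltrD//.
    by rewrite distrC (lt_trans yz).
  have yx : `|y - x| < rho by rewrite (lt_trans xy')// gtr_pMr// invf_lt1 ?ltr1n.
  rewrite (le_lt_trans (ler_distD (w x) _ _))// (splitr e) ltrD ?xrho//.
  by rewrite distrC xrho.
move=> covr; near (0 : R)^'+ => rho; exists rho => // x y Dx Dy xy.
by have := near covr rho; apply.
Unshelve. all: by end_near. Qed.

Lemma within_continuous_bounded D f : compact D -> {within D, continuous f} ->
  exists2 B : R, 0 <= B & forall x, D x -> `|f x| <= B.
Proof.
move=> cD cf; have [->|/set0P D0] := eqVneq D set0; first by exists 0.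
have cNf : {within D, continuous (fun x => `|f x|)}.
  by move=> x; apply: cvg_norm; exact: cf.
have [b Db bmax] := compact_EVT_max D0 cD cNf.
exists `|f b| => // x Dx; apply: bmax; exact/mem_set.
Qed.

Lemma local_min_on_ball D f p (rho : R) : D p -> 0 < rho ->
  (forall x, D x -> `|x - p| < rho -> f p <= f x) -> local_min_on D f p.
Proof.
move=> Dp rho0 fp; split=> //; rewrite near_withinE; apply/nbhs_ballP.
exists rho => //= x; rewrite -ball_normE /= distrC => xp Dx; exact: fp.
Qed.

Lemma local_max_on_opp D f p :
  local_min_on D (fun x => - f x) p -> local_max_on D f p.
Proof.
case=> Dp fp; split=> //; apply: filterS fp => x; by rewrite lerN2.
Qed.

Lemma continuous_quad c (a g : 'rV[R]_n) (M : 'M[R]_n) : continuous (quad c a g M).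
Proof. by move=> x; exact/differentiable_continuous/differentiable_quad. Qed.

Lemma closed_quad_le c (a g : 'rV[R]_n) (M : 'M[R]_n) k :
  closed [set x | quad c a g M x <= k].
Proof.
rewrite (_ : [set _ | _] = quad c a g M @^-1` [set y | y <= k])//.
by apply: closed_comp (@closed_le _ k) => x _; exact: continuous_quad.
Qed.

End semicontinuity_and_extrema.

(** * Concavity along a segment from the second-order condition *)

Section concavity.
Context {R : realType} {n : nat}.
Variables (D : set 'rV[R]_n) (f : 'rV[R]_n -> R) (a d : 'rV[R]_n) (rho : R).
Hypotheses (cD : compact D) (cf : {within D, continuous f}).
Hypotheses (Dseg : forall s : R, 0 <= s <= 1 -> D (a + s *: d)) (rho0 : 0 < rho).
Hypothesis hess_le0 : forall c g M x, M^T = M ->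
  local_min_on D (fun y => f y - quad c a g M y) x ->
  (exists2 s : R, 0 <= s <= 1 & `|x - (a + s *: d)| <= rho) ->
  dot (d *m M) d <= 0.

(** [hess_le0] speaks only of minimisers within [rho] of the segment: in the application [d] is
    known to be a tangent direction there, but not near the boundary of the simplex. *)
Lemma viscosity_concave s : 0 <= s <= 1 ->
  (1 - s) * f a + s * f (a + d) <= f (a + s *: d).
Proof.
move=> s01; rewrite leNgt; apply/negP => gap.
have [d0|d0] := eqVneq d 0.
  by move: gap; rewrite d0 scaler0 addr0 -mulrDl subrK mul1r ltxx.
have dd0 := dot_gt0 d0; set dd := dot d d in dd0.
(* Minimise [f] minus a test function near the segment: [t] is the coordinate
   along the segment, [perp] the squared distance to its line, and the test
   function is the chord of [f], bent convexly by [gam (t^2 - t)], minus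
   [N perp]. The size of the gap keeps the minimiser off the ends of the
   segment, and [N] keeps it close to the line. *)
pose gam := (1 - s) * f a + s * f (a + d) - f (a + s *: d).
have gam0 : 0 < gam by rewrite subr_gt0.
(* As instances of [quad], [t] and [perp] come with continuity and closed sublevel sets. *)
pose t := quad 0 a (dd^-1 *: d) 0.
have tE y : t y = dot d (y - a) / dd.
  by rewrite /t /quad mulmx0 dot0l mul0r addr0 add0r dotZl mulrC.
pose perp := quad 0 a 0 (2 *: (1%:M - dd^-1 *: (d^T *m d))).
have perpE y : perp y = dot (y - a) (y - a) - dd * t y ^+ 2.
  rewrite tE /perp /quad; move: (y - a) => z.
  rewrite dot0l -scalemxAr mulmxBr mulmx1 -scalemxAr dot_outer !dotE (dotC z d).
  rewrite -/dd; field; exact: lt0r_neq0.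
have perp_dist y : perp y = dot (y - (a + t y *: d)) (y - (a + t y *: d)).
  rewrite perpE opprD addrA; move: (tE y); move: (t y) => z.
  move: (y - a) => x -> ; rewrite !dotE -/dd (dotC x d); field; exact: lt0r_neq0.
have D0 : D a by have := @Dseg 0; rewrite lexx ler01 scale0r addr0; apply.
have D1 : D (a + d) by have := @Dseg 1; rewrite lexx ler01 scale1r; apply.
have gam2 : 0 < gam / 2 by rewrite divr_gt0.
have [rho1 rho10 near_a] := within_continuous_dist cf D0 gam2.
have [rho2 rho20 near_b] := within_continuous_dist cf D1 gam2.
have [B B0 fB] := within_continuous_bounded cD cf.
have m0 : 0 < Num.min rho (Num.min rho1 rho2) by rewrite !lt_min rho0 rho10.
pose c := Num.min rho (Num.min rho1 rho2) / 2.
have c0 : 0 < c by rewrite divr_gt0.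
have [crho crho1 crho2] : [/\ c < rho, c < rho1 & c < rho2].
  have : c < Num.min rho (Num.min rho1 rho2) by rewrite /c; lra.
  by rewrite !lt_min => /and3P[].
have enorm_perp y : perp y <= c ^+ 2 -> enorm (y - (a + t y *: d)) <= c.
  by rewrite perp_dist => /(enorm_le (ltW c0)).
(* Where [perp] equals [c ^+ 2] the penalty is [2 * B + 1], which makes [phi - f] negative there. *)
pose N := (2 * B + 1) / c ^+ 2.
(* [perp] is constant along [d], so [M] has the value [2 * gam] on [d]; its positivity is the final
   contradiction. *)
pose M := (- 2 * N)%:M + (2 * gam / dd ^+ 2 + 2 * N / dd) *: (d^T *m d).
have MT : M^T = M.
  by rewrite linearD linearZ/= tr_scalar_mx trmx_mul trmxK.
pose phi := quad (f a) a (((f (a + d) - f a - gam) / dd) *: d) M.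
have phiE y : phi y = (1 - t y) * f a + t y * f (a + d)
    + gam * (t y ^+ 2 - t y) - N * perp y.
  rewrite perpE tE /phi /quad; move: (y - a) => z.
  rewrite mulmxDr mul_mx_scalar -scalemxAr dot_outer !dotE (dotC z d).
  rewrite -/dd; field; exact: lt0r_neq0.
pose K := D `&` [set y | t y <= 1] `&` [set y | - t y <= 0] `&`
  [set y | perp y <= c ^+ 2].
have KD : K `<=` D by move=> y [[[]]].
have cK : compact K.
  have tN : [set y | - t y <= 0] = [set y | quad 0 a (- dd^-1 *: d) 0 y <= 0].
    apply/seteqP; split=> y; rewrite /= /quad /t mulmx0 dot0l !mul0r !add0r;
    by rewrite /quad mulmx0 dot0l !mul0r !add0r !addr0 scaleNr dotNl.
  by rewrite /K tN; do 3 (apply: compact_closedI; last exact: closed_quad_le).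
have ts : t (a + s *: d) = s.
  by rewrite tE addrC addKr dotZr -/dd mulfK// lt0r_neq0.
have mK : K (a + s *: d).
  case/andP: (s01) => s0 s1; split=> /=; last first.
    by rewrite perp_dist ts subrr dot0l sqr_ge0.
  by split; [split; [exact: Dseg|rewrite /= ts]|rewrite /= ts oppr_le0].
have cG : {within K, continuous (fun y => phi y - f y)}.
  move=> y; apply: cvgB.
    by apply: continuous_subspaceT => z; exact: continuous_quad.
  exact: (continuous_subspaceW KD cf).
have [x /set_mem Kx xmax] := compact_EVT_max (ex_intro _ _ mK) cK cG.
have xm := xmax _ (mem_set mK).
case: (Kx) => -[[Dx /= t1] /= t0'] /= px; have t0 : 0 <= t x by rewrite -oppr_le0.
(* At the point of parameter [s] the difference is gam (s^2 - s + 1), at least 3 gam / 4; where [t]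
   is 0 or 1 it is below gam / 2. *)
have gap' : gam / 2 < phi x - f x.
  apply: lt_le_trans xm; rewrite phiE ts perp_dist ts subrr dot0l mulr0 subr0.
  have -> : (1 - s) * f a + s * f (a + d) + gam * (s ^+ 2 - s)
      - f (a + s *: d) = gam * (s ^+ 2 - s + 1) by rewrite /gam; ring.
  by rewrite ltr_pM2l//; have := sqr_ge0 (s - 1 / 2); lra.
have N0 : 0 <= N by rewrite divr_ge0 ?sqr_ge0//; lra.
have perp0 : 0 <= perp x by rewrite perp_dist dot_ge0.
have /andP[fxB fxB'] : - B <= f x <= B by rewrite -ler_norml fB.
have tx0 : 0 < t x.
  rewrite lt_def t0 andbT; apply/eqP => tx; move: gap'; rewrite phiE tx.
  have : `|f x - f a| < gam / 2.
    apply: near_a => //; apply: le_lt_trans crho1.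
    apply: le_trans (norm_le_enorm _) _.
    by have := enorm_perp x px; rewrite tx scale0r addr0.
  by rewrite ltr_norml => /andP[? ?]; have := mulr_ge0 N0 perp0; lra.
have tx1 : t x < 1.
  rewrite lt_def t1 andbT eq_sym; apply/eqP => tx; move: gap'; rewrite phiE tx.
  have : `|f x - f (a + d)| < gam / 2.
    apply: near_b => //; apply: le_lt_trans crho2.
    apply: le_trans (norm_le_enorm _) _.
    by have := enorm_perp x px; rewrite tx scale1r.
  by rewrite ltr_norml => /andP[? ?]; have := mulr_ge0 N0 perp0; lra.
have pxc : perp x < c ^+ 2.
  rewrite lt_def px andbT eq_sym; apply/eqP => pxc; move: gap'; rewrite phiE pxc.
  rewrite /N divfK ?sqrf_eq0 ?lt0r_neq0//.
  have /andP[? ?] : - B <= f a <= B by rewrite -ler_norml fB.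
  have /andP[? ?] : - B <= f (a + d) <= B by rewrite -ler_norml fB.
  have : 0 <= (1 - t x) * (B - f a) by rewrite mulr_ge0 ?subr_ge0.
  have : 0 <= t x * (B - f (a + d)) by rewrite mulr_ge0 ?subr_ge0.
  have : 0 <= gam * (t x * (1 - t x)) by rewrite !mulr_ge0 ?subr_ge0// ltW.
  by lra.
have : dot (d *m M) d <= 0.
  apply: (@hess_le0 (f a) (((f (a + d) - f a - gam) / dd) *: d) M x) => //.
    (* The constraints other than membership in [D] are strict at [x], so [K] contains a
       neighbourhood of [x] relative to [D]. *)
    split=> //; rewrite near_withinE.
    have ct := @continuous_quad _ _ 0 a (dd^-1 *: d) 0 x.
    have cp := @continuous_quad _ _ 0 a 0 (2 *: (1%:M - dd^-1 *: (d^T *m d))) x.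
    have := cvgr_gt _ ct _ tx0; have := cvgr_lt _ ct _ tx1; have := cvgr_lt _ cp _ pxc.
    move=> np n1 n0; near=> y => Dy.
    have /mem_set/xmax : K y.
      split; last by apply: ltW; near: y; exact: np.
      split; last by rewrite /= oppr_le0 ltW//; near: y; exact: n0.
      by split=> //=; apply: ltW; near: y; exact: n1.
    by rewrite -/phi; lra.
  exists (t x); first by rewrite t0.
  apply: le_trans (norm_le_enorm _) _; apply: le_trans (enorm_perp x px) _.
  exact: ltW.
rewrite mulmxDr mul_mx_scalar -scalemxAr dot_outer !dotE -/dd.
have -> : - 2 * N * dd + (2 * gam / dd ^+ 2 + 2 * N / dd) * (dd * dd) = 2 * gam.
  by field; exact: lt0r_neq0.
by rewrite pmulr_rle0// leNgt gam0.
Unshelve. all: by end_near. Qed.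

End concavity.

(** * The slope of a concave function at an interior point *)

Section supergradient.
Context {R : realType} {n : nat}.
Variables (D : set 'rV[R]_n) (f : 'rV[R]_n -> R) (p d : 'rV[R]_n) (rho : R).
Hypotheses (cD : compact D) (cf : {within D, continuous f}).
Hypotheses (Dseg : forall s : R, -1 <= s <= 1 -> D (p + s *: d)) (rho0 : 0 < rho).
Hypothesis hess_le0 : forall c a g M x, M^T = M ->
  local_min_on D (fun y => f y - quad c a g M y) x ->
  (exists2 s : R, -1 <= s <= 1 & `|x - (p + s *: d)| <= rho) ->
  dot (d *m M) d <= 0.

(* A concave function touched from below at [p] by a smooth function has no
   other slope at [p] than that of the smooth function. *)
Lemma viscosity_supergradient (q C : R) :
  (forall t, 0 <= t <= 1 -> f p - t * q - C * t ^+ 2 <= f (p - t *: d)) ->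
  f (p + d) <= f p + q.
Proof.
move=> touch.
(* The point [p] sits at parameter t / (1 + t) of the segment from [p - t *: d] to [p + d]; the
   concavity inequality is multiplied by 1 + t. *)
have concave (t : R) : 0 < t <= 1 -> f (p - t *: d) + t * f (p + d) <= (1 + t) * f p.
  move=> /andP[t0 t1]; have t1' : 1 + t != 0 by rewrite gt_eqF//; lra.
  pose a := p - t *: d; pose e := (1 + t) *: d.
  have ae (s : R) : a + s *: e = p + (s * (1 + t) - t) *: d.
    by rewrite /a /e scalerA -addrA -scaleNr -scalerDl [- t + _]addrC.
  have range (s : R) : 0 <= s <= 1 -> -1 <= s * (1 + t) - t <= 1.
    by case/andP => s0 s1; apply/andP; split; nra.
  have seg (s : R) : 0 <= s <= 1 -> D (a + s *: e).
    by move=> /range; rewrite ae; exact: Dseg.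
  have hess c g M x : M^T = M ->
      local_min_on D (fun y => f y - quad c a g M y) x ->
      (exists2 s : R, 0 <= s <= 1 & `|x - (a + s *: e)| <= rho) ->
      dot (e *m M) e <= 0.
    move=> MT xmin [s s01 xs].
    rewrite /e -scalemxAl dotZl dotZr mulrA -expr2 mulr_ge0_le0 ?sqr_ge0//.
    apply: hess_le0 MT xmin _.
    by exists (s * (1 + t) - t); rewrite ?range// -ae.
  have t01 : 0 <= t / (1 + t) <= 1.
    by apply/andP; split; [rewrite divr_ge0|rewrite ler_pdivrMr]; lra.
  have := viscosity_concave cD cf seg rho0 hess t01.
  have -> : a + e = p + d by rewrite -[e]scale1r ae mul1r addrK scale1r.
  rewrite ae divfK// subrr scale0r addr0.
  have -> : 1 - t / (1 + t) = (1 + t)^-1 by field.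
  by rewrite [t / _]mulrC -mulrA -mulrDr ler_pdivrMl//; lra.
apply/ler_addgt0Pr => e e0.
(* Inserting [touch] and dividing by [t] leaves the error [C * t], which this choice keeps below
   [e]. *)
pose t := Num.min 1 (e / (`|C| + 1)).
have C1 : 0 < `|C| + 1 by rewrite ltr_pwDr.
have t0 : 0 < t by rewrite lt_min ltr01 divr_gt0.
have t1 : t <= 1 by rewrite ge_min lexx.
have tC : t * (`|C| + 1) <= e by rewrite -ler_pdivlMr// ge_min lexx orbT.
have := touch t; rewrite t1 ltW// => /(_ isT) h1.
have := concave t; rewrite t1 t0 => /(_ isT) h2.
have h3 : t * f (p + d) <= t * (f p + q + C * t) by lra.
move: h3; rewrite ler_pM2l// => /le_trans; apply; rewrite lerD2l.
apply: le_trans tC; rewrite mulrC ler_pM2l//.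
by apply: le_trans (ler_norm _) _; rewrite lerDl.
Qed.

End supergradient.

(** * Geometry of the simplex and extreme eigenvalues on its tangent spaces *)

Section simplex.
Context {R : realType} {n : nat}.
Implicit Types (p z : 'rV[R]_n).

Lemma coord_le_norm z i : `|z 0 i| <= `|z|.
Proof.
rewrite [X in _ <= X]mx_normrE.
exact: (le_bigmax _ (fun ij => `|z ij.1 ij.2|) (0, i)).
Qed.

Lemma simplex_shift p z c : simplex p -> (forall i, c <= p 0 i) ->
  \sum_i z 0 i = 0 -> `|z| <= c -> simplex (p + z).
Proof.
move=> [_ p1] cp z0 zc; split=> [i|]; last first.
  by under eq_bigr do rewrite mxE; rewrite big_split/= p1 z0 addr0.
have : `|z 0 i| <= c.
  exact: le_trans (coord_le_norm _ _) zc.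
by rewrite ler_norml mxE => /andP[? _]; have := cp i; lra.
Qed.

Lemma simplex_shift_segment p z c (s : R) : simplex p -> 0 < c ->
  (forall i, c <= p 0 i) -> \sum_i z 0 i = 0 -> `|z| <= c / 2 ->
  -1 <= s <= 1 ->
  simplex (p + s *: z) /\ forall i, c / 2 <= (p + s *: z) 0 i.
Proof.
move=> sp c0 cp z0 zc s1; have nz : `|s *: z| <= c / 2.
  by rewrite normrZ; apply: le_trans zc; rewrite ler_piMl// ler_norml.
split=> [|i].
  apply: simplex_shift cp _ _ => //; last by apply: (le_trans nz); lra.
  by under eq_bigr do rewrite mxE; rewrite -mulr_sumr z0 mulr0.
have := le_trans (coord_le_norm _ i) nz.
by rewrite ler_norml !mxE => /andP[? _]; have := cp i; lra.
Qed.

Lemma tangent_interior p z c : simplex p -> 0 < c -> (forall i, c <= p 0 i) ->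
  \sum_i z 0 i = 0 -> tangent p z.
Proof.
move=> sp c0 cp z0; have z1 : 0 < `|z| + 1 by rewrite ltr_pwDr.
exists (c / (`|z| + 1)); first exact: divr_gt0.
have sz (b : R) : \sum_i (b *: z) 0 i = 0.
  by under eq_bigr do rewrite mxE; rewrite -mulr_sumr z0 mulr0.
have nz : `|(c / (`|z| + 1)) *: z| <= c.
  have cz : 0 <= c / (`|z| + 1) by rewrite divr_ge0 ?ltW.
  rewrite normrZ (ger0_norm cz) mulrAC ler_pdivrMr// ler_pM2l//.
  by rewrite lerDl.
split; apply: simplex_shift cp _ _ => //.
  by rewrite -scaleNr sz.
by rewrite normrN.
Qed.

Lemma simplex_sub p q : simplex p -> simplex q -> \sum_i (p - q) 0 i = 0.
Proof.
move=> [_ p1] [_ q1]; under eq_bigr do rewrite !mxE.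
by rewrite big_split/= sumrN p1 q1 subrr.
Qed.

Lemma simplex_coord_le1 p i : simplex p -> p 0 i <= 1.
Proof. by move=> [p0 <-]; rewrite (bigD1 i)//= lerDl sumr_ge0. Qed.

Lemma simplex_dot_le1 p : simplex p -> dot p p <= 1.
Proof.
move=> sp; have [p0 p1] := sp; rewrite -[leRHS]p1; apply: ler_sum => i _.
by rewrite ler_piMl// simplex_coord_le1.
Qed.

Lemma simplex_enorm_le1 p : simplex p -> enorm p <= 1.
Proof. by move=> sp; rewrite enorm_le// expr1n simplex_dot_le1. Qed.

Lemma simplex_convex p q (t : R) : simplex p -> simplex q -> 0 <= t <= 1 ->
  simplex ((1 - t) *: p + t *: q).
Proof.
move=> [p0 p1] [q0 q1] /andP[t0 t1]; split=> [i|].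
  by rewrite !mxE addr_ge0 ?mulr_ge0 ?subr_ge0.
under eq_bigr do rewrite !mxE.
by rewrite big_split -!mulr_sumr p1 q1 /= !mulr1 subrK.
Qed.

Lemma lambda_max_le0 p z (M : 'M[R]_n) : M^T = M ->
  (lambda_max p M <= 0)%E -> tangent p z -> dot (z *m M) z <= 0.
Proof.
move=> MT M0 pz; have [->|z0] := eqVneq z 0; first by rewrite dot0r.
have : (rayleigh M z)%:E \in [set (rayleigh M y)%:E | y in tangent p `\ 0].
  by apply/mem_set; exists z => //; split=> // /eqP; exact/negP.
move=> /set_mem/ereal_sup_ubound/le_trans/(_ M0).
rewrite lee_fin /rayleigh MT ler_pdivrMr ?mul0r// exprn_gt0//.
by rewrite sqrtr_gt0 dot_gt0.
Qed.

Lemma lambda_minN p (M : 'M[R]_n) : lambda_min p (- M) = (- lambda_max p M)%E.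
Proof.
rewrite /lambda_min /lambda_max /ereal_inf; congr (- ereal_sup _)%E.
rewrite image_comp; apply: eq_imagel => z _ /=.
by rewrite /rayleigh linearN/= mulmxN dotNl mulNr opprK.
Qed.

(** The Rayleigh quotient is constantly [c]. At a vertex the supremum is over the empty set and
    equals -oo, so strictness survives there. *)
Lemma lambda_max_scalar_lt0 p c : c < 0 -> (lambda_max p c%:M < 0)%E.
Proof.
move=> c0; apply: (@le_lt_trans _ _ c%:E); last by rewrite lte_fin.
apply: ge_ereal_sup => _ [z [_ z0] <-]; rewrite lee_fin.
have z1 : 0 < dot z z by apply: dot_gt0; exact/eqP.
by rewrite /rayleigh enorm_sqr tr_scalar_mx mul_mx_scalar dotZl mulfK ?gt_eqF.
Qed.

End simplex.

(** * Consequences of the viscosity inequalities for quadratic tests *)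

Section viscosity_with_quadratic_tests.
Context {R : realType} {S1 S2 : finType}.
Local Notation E := 'rV[R]_(#|S1| + #|S2|).
Local Notation D := (Delta2 R S1 S2).
Variables (r : R) (H : E -> E -> R).
Implicit Types (w : E -> R) (a g p : E) (M : 'M[R]_(#|S1| + #|S2|)).

Lemma Delta2_row_mx (p1 : 'rV[R]_#|S1|) (p2 : 'rV[R]_#|S2|) :
  simplex p1 -> simplex p2 -> D (row_mx p1 p2).
Proof. by move=> sp1 sp2; split; rewrite (row_mxKl, row_mxKr). Qed.

Lemma compact_Delta2 : compact D.
Proof.
pose cube : set E := [set p | forall i, `[0, 1]%classic (p ord0 i)].
have cube_cpt : compact cube.
  exact: (rV_compact (fun=> @segment_compact R 0 1)).
have closed_coord (i : 'I_(#|S1| + #|S2|)) : closed [set p : E | 0 <= p 0 i].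
  rewrite (_ : [set p | _] = (fun p : E => p 0 i) @^-1` [set y | 0 <= y])//.
  by apply: closed_comp (@closed_ge _ 0) => p _; exact: coord_continuous.
have closed_sum n (h : 'I_n -> 'I_(#|S1| + #|S2|)) :
    closed [set p : E | \sum_i p 0 (h i) = 1].
  rewrite (_ : [set p | _] = (fun p : E => \sum_i p 0 (h i)) @^-1` [set 1])//.
  apply: closed_comp (@closed_eq _ 1) => p _.
  apply: differentiable_continuous; rewrite -fct_sumE.
  by apply: differentiable_sum => i; exact: differentiable_coord.
rewrite (_ : D = cube `&` [set p | \sum_i p 0 (lshift #|S2| i) = 1]
    `&` [set p | \sum_i p 0 (rshift #|S1| i) = 1]).
  by do 2 (apply: compact_closedI; last exact: closed_sum).
apply/seteqP; split=> p.
  move=> [[p0 p1] [q0 q1]]; have := simplex_coord_le1 _ (conj p0 p1).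
  have := simplex_coord_le1 _ (conj q0 q1) => qle1 ple1.
  split; first split.
  - move=> i; rewrite /= in_itv /=.
    case: (splitP i) => j ij.
      have := p0 j; have := ple1 j; rewrite !mxE.
      by rewrite (_ : lshift _ j = i) => [-> ->//|]; exact: val_inj.
    have := q0 j; have := qle1 j; rewrite !mxE.
    by rewrite (_ : rshift _ j = i) => [-> ->//|]; exact: val_inj.
  - by rewrite /= -[RHS]p1; apply: eq_bigr => i _; rewrite mxE.
  - by rewrite /= -[RHS]q1; apply: eq_bigr => i _; rewrite mxE.
move=> [[pc /= p1] q1]; split; split.
- by move=> i; have := pc (lshift _ i); rewrite /= in_itv mxE => /andP[].
- by rewrite -[RHS]p1; apply: eq_bigr => i _; rewrite mxE.
- by move=> i; have := pc (rshift _ i); rewrite /= in_itv mxE => /andP[].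
- by rewrite -[RHS]q1; apply: eq_bigr => i _; rewrite mxE.
Qed.

(** Here [- lambda_max] stands in the outer minimum, so every test function yields this bound
    whatever the Hamiltonian. *)
Lemma supersolution_hessian w c a g M p (z : 'rV[R]_#|S1|) :
  viscosity_supersolution r H w -> M^T = M ->
  local_min_on D (fun x => w x - quad c a g M x) p ->
  tangent (lsubmx p) z -> dot (row_mx z 0 *m M) (row_mx z 0) <= 0.
Proof.
move=> [_ sup] MT /(sup _ _ (smooth_quad c a g MT)).
rewrite le_min /hess11 hessian_quad// => /andP[_].
rewrite oppe_ge0 => lam pz; rewrite -[M]submxK mul_row_block !mul0mx !addr0.
rewrite dot_row_mx dot0r addr0; apply: lambda_max_le0 lam pz.
by rewrite trmx_ulsub MT.
Qed.

(** Strict convexity in the second variable makes [- lambda_min] negative, so only the Hamiltonian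
    can make the inner maximum nonnegative. *)
Lemma supersolution_hamiltonian w c a g M p (b : R) :
  viscosity_supersolution r H w -> M^T = M ->
  local_min_on D (fun x => w x - quad c a g M x) p ->
  drsubmx M = b%:M -> 0 < b -> 0 <= r * w p + H p (g + (p - a) *m M).
Proof.
move=> [_ sup] MT /(sup _ _ (smooth_quad c a g MT)).
rewrite le_min /hess22 hessian_quad// gradient_quad// => /andP[+ _] Mb b0; rewrite Mb.
rewrite le_max lee_fin => /orP[//|].
rewrite (_ : b%:M = - (- b)%:M); last by rewrite raddfN opprK.
have Nb0 : - b < 0 by rewrite oppr_lt0.
by rewrite lambda_minN oppeK leNgt lambda_max_scalar_lt0.
Qed.

Lemma subsolution_hessian w c a g M p (z : 'rV[R]_#|S2|) :
  viscosity_subsolution r H w -> M^T = M ->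
  local_max_on D (fun x => w x - quad c a g M x) p ->
  tangent (rsubmx p) z -> 0 <= dot (row_mx 0 z *m M) (row_mx 0 z).
Proof.
move=> [_ sub] MT /(sub _ _ (smooth_quad c a g MT)).
rewrite ge_max /hess22 hessian_quad// => /andP[_].
rewrite -[drsubmx M]opprK lambda_minN oppeK => lam pz.
rewrite -[M]submxK mul_row_block !mul0mx !add0r dot_row_mx dot0r add0r.
rewrite -oppr_le0 -dotNl -mulmxN; apply: lambda_max_le0 lam pz.
by rewrite linearN/= trmx_drsub MT.
Qed.

Lemma subsolution_hamiltonian w c a g M p (b : R) :
  viscosity_subsolution r H w -> M^T = M ->
  local_max_on D (fun x => w x - quad c a g M x) p ->
  ulsubmx M = b%:M -> b < 0 -> r * w p + H p (g + (p - a) *m M) <= 0.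
Proof.
move=> [_ sub] MT /(sub _ _ (smooth_quad c a g MT)).
rewrite ge_max /hess11 hessian_quad// gradient_quad// => /andP[+ _] Mb b0; rewrite Mb.
rewrite ge_min lee_fin => /orP[//|].
by rewrite oppe_le0 leNgt lambda_max_scalar_lt0.
Qed.

Lemma supersolution_supergradient w (p1 z : 'rV[R]_#|S1|) (p2 : 'rV[R]_#|S2|)
    (c q C : R) :
  viscosity_supersolution r H w -> {within D, continuous w} ->
  simplex p1 -> simplex p2 -> 0 < c -> (forall i, c <= p1 0 i) ->
  \sum_i z 0 i = 0 -> `|z| <= c / 2 ->
  (forall t, 0 <= t <= 1 ->
    w (row_mx p1 p2) - t * q - C * t ^+ 2 <= w (row_mx (p1 - t *: z) p2)) ->
  w (row_mx (p1 + z) p2) <= w (row_mx p1 p2) + q.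
Proof.
move=> sup cw sp1 sp2 c0 cp1 z0 zc touch.
have seg (s : R) : row_mx p1 p2 + s *: row_mx z 0 = row_mx (p1 + s *: z) p2.
  by rewrite scale_row_mx scaler0 add_row_mx addr0.
have sz (s : R) := simplex_shift_segment (s := s) sp1 c0 cp1 z0 zc.
have -> : row_mx (p1 + z) p2 = row_mx p1 p2 + row_mx z 0.
  by rewrite -[row_mx z 0]scale1r seg scale1r.
(* Coordinates are at least [c / 2] on the segment, hence at least [c / 4] within distance [c / 4]
   of it, where [z] is therefore tangent. *)
have c4 : 0 < c / 4 by rewrite divr_gt0.
apply: (viscosity_supergradient compact_Delta2 cw _ c4 _ (C := C)).
- by move=> s /sz[? _]; rewrite seg; exact: Delta2_row_mx.
- move=> c' a g M x MT xmin [s /sz[sx cx] xs].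
  have [[sx1 _] _] := xmin.
  apply: supersolution_hessian sup MT xmin _.
  apply: (tangent_interior (c := c / 4)) => // i.
  move: xs; rewrite seg => /(le_trans (coord_le_norm _ (lshift _ i))).
  by have := cx i; rewrite !mxE (unsplitK (inl _)) ler_norml !mxE; lra.
- move=> t t01; rewrite -[- (t *: row_mx _ _)]scaleNr seg scaleNr; exact: touch.
Qed.

(** The supergradient argument for [- w]: touching from above becomes touching from below, and the
    negative of a [quad] is a [quad]. *)
Lemma subsolution_subgradient w (p1 : 'rV[R]_#|S1|) (p2 z : 'rV[R]_#|S2|)
    (c q C : R) :
  viscosity_subsolution r H w -> {within D, continuous w} ->
  simplex p1 -> simplex p2 -> 0 < c -> (forall i, c <= p2 0 i) ->
  \sum_i z 0 i = 0 -> `|z| <= c / 2 ->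
  (forall t, 0 <= t <= 1 ->
    w (row_mx p1 (p2 - t *: z)) <= w (row_mx p1 p2) - t * q + C * t ^+ 2) ->
  w (row_mx p1 p2) + q <= w (row_mx p1 (p2 + z)).
Proof.
move=> sub cw sp1 sp2 c0 cp2 z0 zc touch.
have seg (s : R) : row_mx p1 p2 + s *: row_mx 0 z = row_mx p1 (p2 + s *: z).
  by rewrite scale_row_mx scaler0 add_row_mx addr0.
have sz (s : R) := simplex_shift_segment (s := s) sp2 c0 cp2 z0 zc.
have -> : row_mx p1 (p2 + z) = row_mx p1 p2 + row_mx 0 z.
  by rewrite -[row_mx 0 z]scale1r seg scale1r.
have c4 : 0 < c / 4 by rewrite divr_gt0.
have cNw : {within D, continuous (fun x => - w x)}.
  by move=> x; apply: cvgN; exact: cw.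
rewrite -lerN2 opprD.
apply: (viscosity_supergradient compact_Delta2 cNw _ c4 _ (C := C)).
- by move=> s /sz[? _]; rewrite seg; exact: Delta2_row_mx.
- move=> c' a g M x MT xmin [s /sz[sx cx] xs].
  have [[_ sx2] _] := xmin.
  rewrite -oppr_ge0 -dotNl -mulmxN.
  apply: (@subsolution_hessian w (- c') a (- g)) sub _ _ _.
  + by rewrite linearN/= MT.
  + apply: local_max_on_opp; move: xmin; congr (local_min_on _ _ _).
    by apply/funext => y; rewrite /quad mulmxN !dotNl; ring.
  apply: (tangent_interior (c := c / 4)) => // i.
  move: xs; rewrite seg => /(le_trans (coord_le_norm _ (rshift _ i))).
  by have := cx i; rewrite !mxE (unsplitK (inr _)) ler_norml !mxE; lra.
- move=> t t01; rewrite -[- (t *: row_mx _ _)]scaleNr seg scaleNr.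
  by have := touch t t01; lra.
Qed.

End viscosity_with_quadratic_tests.

(** * The doubled function and the Hamiltonian inequalities at its maximum *)

Section doubling_of_variables.
Context {R : realType} {S1 S2 : finType}.
Local Notation E := 'rV[R]_(#|S1| + #|S2|).
Local Notation D := (Delta2 R S1 S2).
Variables (r : R) (H : E -> E -> R) (w1 w2 : E -> R).
Hypotheses (sub1 : viscosity_subsolution r H w1) (cw1 : {within D, continuous w1}).
Hypotheses (sup2 : viscosity_supersolution r H w2) (cw2 : {within D, continuous w2}).
Variables (eps delta eta : R) (u1 : 'rV[R]_#|S1|) (u2 : 'rV[R]_#|S2|).
Hypotheses (eps0 : 0 < eps) (delta0 : 0 < delta) (eta01 : 0 < eta < 1).

(* The coupling vanishes at [q = (1 - eta) p + eta u], not at [q = p]: with [u]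
   the barycentre, this keeps [q] in the interior of the simplex. *)
Definition shift_gap n (u p q : 'rV[R]_n) := q - (1 - eta) *: p - eta *: u.

(** The two couplings run in opposite directions: q1 follows p1, but p2 follows q2. The [eps] terms
    involve only the leading variables p1 and q2; they make the tests strictly concave in p1 and
    strictly convex in q2. *)
Definition doubled (p q : E) : R :=
  w1 p - w2 q + eps * (dot (lsubmx p) (lsubmx p) + dot (rsubmx q) (rsubmx q))
  - (dot (shift_gap u1 (lsubmx p) (lsubmx q)) (shift_gap u1 (lsubmx p) (lsubmx q))
     + dot (shift_gap u2 (rsubmx q) (rsubmx p)) (shift_gap u2 (rsubmx q) (rsubmx p)))
    / (2 * delta).

Lemma norm_submx_le (x : E) (p1 : 'rV[R]_#|S1|) (p2 : 'rV[R]_#|S2|) b :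
  `|x - row_mx p1 p2| < b -> `|lsubmx x - p1| < b /\ `|rsubmx x - p2| < b.
Proof.
move=> xb; have b0 : 0 < b by exact: le_lt_trans xb.
have normlt n (z : 'rV[R]_n) : (forall i, `|z 0 i| < b) -> `|z| < b.
  move=> zb; rewrite [ltLHS]mx_normrE; apply/bigmax_ltP; split=> // -[i j] _.
  by rewrite (ord1 i) zb.
split; apply: normlt => i.
  apply: le_lt_trans xb; apply: le_trans (coord_le_norm _ (lshift _ i)).
  by rewrite !mxE (unsplitK (inl _)).
apply: le_lt_trans xb; apply: le_trans (coord_le_norm _ (rshift _ i)).
by rewrite !mxE (unsplitK (inr _)).
Qed.

Variables (p1 q1 : 'rV[R]_#|S1|) (p2 q2 : 'rV[R]_#|S2|) (c : R).
Hypotheses (sp1 : simplex p1) (sp2 : simplex p2).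
Hypotheses (sq1 : simplex q1) (sq2 : simplex q2).
Hypothesis doubled_max : forall p q, D p -> D q ->
  doubled p q <= doubled (row_mx p1 p2) (row_mx q1 q2).
Hypotheses (c0 : 0 < c) (cq1 : forall i, c <= q1 0 i) (cp2 : forall i, c <= p2 0 i).
Variables (A : 'rV[R]_#|S1|) (B : 'rV[R]_#|S2|).
Hypotheses (AE : shift_gap u1 p1 q1 = A) (BE : shift_gap u2 q2 p2 = B).

Let maxE x1 x2 y1 y2 : simplex x1 -> simplex x2 -> simplex y1 -> simplex y2 ->
  w1 (row_mx x1 x2) - w2 (row_mx y1 y2) + eps * (dot x1 x1 + dot y2 y2)
  - (dot (shift_gap u1 x1 y1) (shift_gap u1 x1 y1)
     + dot (shift_gap u2 y2 x2) (shift_gap u2 y2 x2)) / (2 * delta)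
  <= w1 (row_mx p1 p2) - w2 (row_mx q1 q2) + eps * (dot p1 p1 + dot q2 q2)
     - (dot A A + dot B B) / (2 * delta).
Proof.
move=> sx1 sx2 sy1 sy2.
have := doubled_max (Delta2_row_mx sx1 sx2) (Delta2_row_mx sy1 sy2).
by rewrite /doubled !row_mxKl !row_mxKr AE BE.
Qed.

Let shift_gapr n (u p q z : 'rV[R]_n) :
  shift_gap u p (q + z) = shift_gap u p q + z.
Proof. by apply/rowP => i; rewrite !mxE; ring. Qed.

(** The joint direction along which the coupling is constant; its factor 1 - eta reappears in the
    gradients at the maximum. *)
Let shift_gapD n (u p q z : 'rV[R]_n) :
  shift_gap u (p + z) (q + (1 - eta) *: z) = shift_gap u p q.
Proof. by apply/rowP => i; rewrite !mxE; ring. Qed.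

(** Varying q1 alone, maximality puts under [w2] a parabola of slope [- A / delta] at q1; as q1 is
    interior, concavity turns that slope into an upper bound. *)
Lemma supergradient_at_max (z : 'rV[R]_#|S1|) : \sum_i z 0 i = 0 -> `|z| <= c / 2 ->
  w2 (row_mx (q1 + z) q2) <= w2 (row_mx q1 q2) - dot A z / delta.
Proof.
move=> z0 zc.
apply: (supersolution_supergradient sup2 cw2 sq1 sq2 c0 cq1 z0 zc
  (C := dot z z / (2 * delta))) => t /andP[t0 t1].
have [| sqt _] := simplex_shift_segment (s := - t) sq1 c0 cq1 z0 zc; first lra.
have := maxE sp1 sp2 sqt sq2; rewrite shift_gapr AE BE scaleNr !dotE (dotC z A).
move=> h.
have -> : w2 (row_mx q1 q2) - t * (- (dot A z / delta))
   - dot z z / (2 * delta) * t ^+ 2 = w2 (row_mx q1 q2)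
   + (dot A A + dot B B) / (2 * delta)
   - (dot A A - t * dot A z - (t * dot A z - t * (t * dot z z)) + dot B B) / (2 * delta).
  by field; rewrite gt_eqF.
lra.
Qed.

Lemma subgradient_at_max (z : 'rV[R]_#|S2|) : \sum_i z 0 i = 0 -> `|z| <= c / 2 ->
  w1 (row_mx p1 p2) + dot B z / delta <= w1 (row_mx p1 (p2 + z)).
Proof.
move=> z0 zc.
apply: (subsolution_subgradient sub1 cw1 sp1 sp2 c0 cp2 z0 zc
  (C := dot z z / (2 * delta))) => t /andP[t0 t1].
have [| spt _] := simplex_shift_segment (s := - t) sp2 c0 cp2 z0 zc; first lra.
have := maxE sp1 spt sq1 sq2; rewrite shift_gapr AE BE scaleNr !dotE (dotC z B).
move=> h.
have -> : w1 (row_mx p1 p2) - t * (dot B z / delta)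
   + dot z z / (2 * delta) * t ^+ 2 = w1 (row_mx p1 p2)
   - (dot A A + dot B B) / (2 * delta)
   + (dot A A + (dot B B - t * dot B z - (t * dot B z - t * (t * dot z z)))) / (2 * delta).
  by field; rewrite gt_eqF.
lra.
Qed.

Let block_tr (a b : R) :
  (block_mx a%:M 0 0 b%:M : 'M[R]_(#|S1| + #|S2|))^T = block_mx a%:M 0 0 b%:M.
Proof. by rewrite tr_block_mx !tr_scalar_mx !trmx0. Qed.

Let quad_block (x1 g1 : 'rV[R]_#|S1|) (x2 g2 : 'rV[R]_#|S2|) (a b : R) (x : E) :
  quad 0 (row_mx x1 x2) (row_mx g1 g2) (block_mx a%:M 0 0 b%:M) x =
  dot g1 (lsubmx x - x1) + dot g2 (rsubmx x - x2)
  + (a * dot (lsubmx x - x1) (lsubmx x - x1)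
     + b * dot (rsubmx x - x2) (rsubmx x - x2)) / 2.
Proof.
rewrite /quad -{1 2 3}[x]hsubmxK opp_row_mx add_row_mx mul_row_block !mulmx0.
by rewrite !mul_mx_scalar addr0 !add0r !dot_row_mx !dotZl.
Qed.

Let scaled_sum0 n (z : 'rV[R]_n) : \sum_i z 0 i = 0 ->
  \sum_i ((1 - eta) *: z) 0 i = 0.
Proof. by move=> z0; under eq_bigr do rewrite mxE; rewrite -mulr_sumr z0 mulr0. Qed.

Let scaled_norm n (z : 'rV[R]_n) b : `|z| < b -> `|(1 - eta) *: z| <= b.
Proof.
case/andP: eta01 => eta0 eta1 zb; rewrite normrZ; apply: le_trans (ltW zb).
by rewrite ler_piMl// ger0_norm; lra.
Qed.

(* Moving [q1] along with [p1] leaves [A] unchanged, so that [w2] enters only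
   through its slope and the test function is concave in [p1]. *)
Lemma subsolution_at_max :
  r * w1 (row_mx p1 p2) + H (row_mx p1 p2)
    (row_mx (- ((1 - eta) / delta) *: A - (2 * eps) *: p1) (delta^-1 *: B)) <= 0.
Proof.
set g := row_mx (- _ *: A - _) _.
(* In p1 only the [eps] term is curved; p2 moves with q2 fixed, so there the coupling contributes
   its full curvature. *)
pose M : 'M[R]_(#|S1| + #|S2|) := block_mx (- (2 * eps))%:M 0 0 (delta^-1)%:M.
have -> : g = g + (row_mx p1 p2 - row_mx p1 p2) *m M by rewrite subrr mul0mx addr0.
apply: (subsolution_hamiltonian (w := w1) (c := 0) (b := - (2 * eps))) => //.
- exact: block_tr.
- apply: local_max_on_opp.
  apply: (@local_min_on_ball _ _ _ _ _ (c / 2)); [exact: Delta2_row_mx|exact: divr_gt0|].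
  move=> x [sx1 sx2] /norm_submx_le[+ _]; rewrite lerN2 !quad_block.
  have -> : w1 x = w1 (row_mx (lsubmx x) (rsubmx x)) by rewrite hsubmxK.
  rewrite !row_mxKl !row_mxKr !subrr !dot0r.
  move: (lsubmx x) (rsubmx x) sx1 sx2 => x1 x2 sx1 sx2.
  have := simplex_sub sx1 sp1; have := maxE sx1 sx2 _ sq2.
  rewrite -[x1](subrK p1) -[x2](subrK p2) !addrK.
  move: (x1 - p1) (x2 - p2) => z y h1 z0 zc.
  have ez0 := scaled_sum0 z0; have ezc := scaled_norm zc.
  have sqz : simplex (q1 + (1 - eta) *: z).
    by apply: simplex_shift cq1 ez0 _ => //; apply: (le_trans ezc); have := c0; lra.
  (* Maximality with q1 moved by (1 - eta) z involves the unknown increment of [w2]; the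
     supergradient bounds it by a linear term. *)
  have := supergradient_at_max ez0 ezc.
  have := h1 _ sqz.
  rewrite (addrC z) (addrC y) shift_gapD shift_gapr AE BE.
  rewrite !dotE (dotC z p1) (dotC y B) => h2 h3.
  have -> : - ((1 - eta) / delta) * dot A z + - (2 * eps * dot p1 z)
     + delta^-1 * dot B y
     + (- (2 * eps) * dot z z + delta^-1 * dot y y) / 2
    = - ((1 - eta) * dot A z / delta) - eps * (2 * dot p1 z + dot z z)
      + (2 * dot B y + dot y y) / (2 * delta).
    by field; rewrite gt_eqF.
  lra.
- by rewrite block_mxKul.
- by rewrite oppr_lt0 mulr_gt0.
Qed.

(** The mirror image: q2 moves by z and p2 by (1 - eta) z, [B] is unchanged, and [w1] enters through
    its subgradient [B / delta]. *)
Lemma supersolution_at_max :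
  0 <= r * w2 (row_mx q1 q2) + H (row_mx q1 q2)
    (row_mx (- delta^-1 *: A) (((1 - eta) / delta) *: B + (2 * eps) *: q2)).
Proof.
set g := row_mx (- _ *: A) _.
pose M : 'M[R]_(#|S1| + #|S2|) := block_mx (- delta^-1)%:M 0 0 (2 * eps)%:M.
have -> : g = g + (row_mx q1 q2 - row_mx q1 q2) *m M by rewrite subrr mul0mx addr0.
apply: (supersolution_hamiltonian (w := w2) (c := 0) (b := 2 * eps)) => //.
- exact: block_tr.
- apply: (@local_min_on_ball _ _ _ _ _ (c / 2)); [exact: Delta2_row_mx|exact: divr_gt0|].
  move=> x [sx1 sx2] /norm_submx_le[_ +]; rewrite !quad_block.
  have -> : w2 x = w2 (row_mx (lsubmx x) (rsubmx x)) by rewrite hsubmxK.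
  rewrite !row_mxKl !row_mxKr !subrr !dot0r.
  move: (lsubmx x) (rsubmx x) sx1 sx2 => x1 x2 sx1 sx2.
  have := simplex_sub sx2 sq2.
  have := fun y2 (sy2 : simplex y2) => maxE sp1 sy2 sx1 sx2.
  rewrite -[x1](subrK q1) -[x2](subrK q2) !addrK.
  move: (x1 - q1) (x2 - q2) => y z h1 z0 zc.
  have ez0 := scaled_sum0 z0; have ezc := scaled_norm zc.
  have spz : simplex (p2 + (1 - eta) *: z).
    by apply: simplex_shift cp2 ez0 _ => //; apply: (le_trans ezc); have := c0; lra.
  have := subgradient_at_max ez0 ezc.
  have := h1 _ spz.
  rewrite (addrC z) (addrC y) shift_gapD shift_gapr AE BE.
  rewrite !dotE (dotC z q2) (dotC y A) => h2 h3.
  have -> : - delta^-1 * dot A y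
     + ((1 - eta) / delta * dot B z + 2 * eps * dot q2 z)
     + (- delta^-1 * dot y y + 2 * eps * dot z z) / 2
    = (1 - eta) * dot B z / delta + eps * (2 * dot q2 z + dot z z)
      - (2 * dot A y + dot y y) / (2 * delta).
    by field; rewrite gt_eqF.
  lra.
- by rewrite block_mxKdr.
- by rewrite mulr_gt0.
Qed.

End doubling_of_variables.

(** * Existence of a maximum of the doubled function *)

Section existence_of_maximum.
Context {R : realType} {S1 S2 : finType}.
Local Notation E := 'rV[R]_(#|S1| + #|S2|).
Local Notation D := (Delta2 R S1 S2).
Variables (w1 w2 : E -> R).
Hypotheses (cw1 : {within D, continuous w1}) (cw2 : {within D, continuous w2}).
Variables (eps delta eta : R) (u1 : 'rV[R]_#|S1|) (u2 : 'rV[R]_#|S2|).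

Lemma continuous_dot (T : topologicalType) n (f : T -> 'rV[R]_n) :
  (forall i, continuous (fun x => f x 0 i : R)) ->
  continuous (fun x => dot (f x) (f x)).
Proof.
move=> cf; rewrite /dot.
apply: (@continuous_big R _ +%R 0 xpredT (@add_continuous R) T _
  (fun i x => f x 0 i * f x 0 i)).
by move=> i _ x; apply: cvgM; exact: cf.
Qed.

Lemma doubled_has_max : D !=set0 -> exists p q, [/\ D p, D q &
  forall x y, D x -> D y -> doubled w1 w2 eps delta eta u1 u2 x y <=
    doubled w1 w2 eps delta eta u1 u2 p q].
Proof.
move=> [p0 Dp0].
have coordl (i : 'I_(#|S1| + #|S2|)) : continuous (fun z : E * E => z.1 0 i : R).
  move=> [x y]; apply: (@cvg_comp _ _ _ fst (fun p : E => p 0 i) _ (nbhs x)).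
    exact: cvg_fst.
  exact: coord_continuous.
have coordr (i : 'I_(#|S1| + #|S2|)) : continuous (fun z : E * E => z.2 0 i : R).
  move=> [x y]; apply: (@cvg_comp _ _ _ snd (fun p : E => p 0 i) _ (nbhs y)).
    exact: cvg_snd.
  exact: coord_continuous.
(* Continuity of [w1] is only relative to [D], so the composition with the projection is carried out
   on filters. *)
have wl : {within D `*` D, continuous (fun z : E * E => w1 z.1)}.
  apply/subspace_continuousP => -[p q] [/= Dp Dq].
  have /subspace_continuousP/(_ _ Dp) := cw1; apply: cvg_comp => A /= nA.
  have := @cvg_fst _ _ (nbhs p) (nbhs q) (nbhs_filter q) _ nA.
  apply: (@filterS _ (nbhs (p, q)) _ _ _ _).
  by move=> [x y] /= xA [Dx _]; exact: xA.
have wr : {within D `*` D, continuous (fun z : E * E => w2 z.2)}.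
  apply/subspace_continuousP => -[p q] [/= Dp Dq].
  have /subspace_continuousP/(_ _ Dq) := cw2; apply: cvg_comp => A /= nA.
  have := @cvg_snd _ _ (nbhs p) (nbhs q) (nbhs_filter p) _ nA.
  apply: (@filterS _ (nbhs (p, q)) _ _ _ _).
  by move=> [x y] /= yA [_ Dy]; exact: yA.
have cdot n (f : E * E -> 'rV[R]_n) : (forall i, continuous (fun x => f x 0 i : R)) ->
    {within D `*` D, continuous (fun x => dot (f x) (f x))}.
  by move=> cf; apply: continuous_subspaceT; exact: continuous_dot.
have cl i : continuous (fun z : E * E => lsubmx z.1 0 i : R).
  have -> : (fun z : E * E => lsubmx z.1 0 i) = fun z => z.1 0 (lshift #|S2| i).
    by apply/funext => z; rewrite mxE.
  exact: coordl.
have cr i : continuous (fun z : E * E => rsubmx z.2 0 i : R).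
  have -> : (fun z : E * E => rsubmx z.2 0 i) = fun z => z.2 0 (rshift #|S1| i).
    by apply/funext => z; rewrite mxE.
  exact: coordr.
have c_gap (f g : E * E -> R) (b : R) : continuous f -> continuous g ->
    continuous (fun z => f z - (1 - eta) * g z - b).
  move=> cf cg z; apply: cvgB; last exact: cvg_cst.
  by apply: cvgB; [exact: cf|apply: cvgM; [exact: cvg_cst|exact: cg]].
have cA i : continuous (fun z : E * E =>
    shift_gap eta u1 (lsubmx z.1) (lsubmx z.2) 0 i : R).
  rewrite (_ : (fun z => _) = fun z : E * E => z.2 0 (lshift #|S2| i)
    - (1 - eta) * z.1 0 (lshift #|S2| i) - eta * u1 0 i); first exact: c_gap.
  by apply/funext => z; rewrite !mxE.
have cB i : continuous (fun z : E * E =>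
    shift_gap eta u2 (rsubmx z.2) (rsubmx z.1) 0 i : R).
  rewrite (_ : (fun z => _) = fun z : E * E => z.1 0 (rshift #|S1| i)
    - (1 - eta) * z.2 0 (rshift #|S1| i) - eta * u2 0 i); first exact: c_gap.
  by apply/funext => z; rewrite !mxE.
have cF : {within D `*` D, continuous
    (fun z => doubled w1 w2 eps delta eta u1 u2 z.1 z.2)}.
  move=> z; apply: cvgB; first apply: cvgD; first apply: cvgB.
  - exact: wl.
  - exact: wr.
  - apply: cvgM; first exact: cvg_cst.
    by apply: cvgD; [exact: (cdot _ _ cl)|exact: (cdot _ _ cr)].
  - apply: cvgM; last exact: cvg_cst.
    by apply: cvgD; [exact: (cdot _ _ cA)|exact: (cdot _ _ cB)].
have DD0 : D `*` D !=set0 by exists (p0, p0).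
have [[p q] /set_mem[Dp Dq] pqmax] :=
  compact_EVT_max DD0 (compact_setX compact_Delta2 compact_Delta2) cF.
by exists p, q; split=> // x y Dx Dy; apply: (pqmax (x, y)); exact/mem_set.
Qed.

End existence_of_maximum.

(** * Comparing the Hamiltonians at the two points *)

Section hamiltonian_estimate.
Context {R : realType} {n1 n2 : nat}.

Lemma enorm_simplex_sub n (p q : 'rV[R]_n) : simplex p -> simplex q ->
  enorm (p - q) <= 2.
Proof.
move=> sp sq; apply: le_trans (enormD _ _) _; rewrite enormN.
by have := simplex_enorm_le1 sp; have := simplex_enorm_le1 sq; lra.
Qed.

Lemma enorm_gap n (u p q : 'rV[R]_n) (eta k : R) : simplex u -> simplex p ->
  0 < eta -> enorm (shift_gap eta u p q) <= k * eta ->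
  enorm (q - p) <= (k + 2) * eta.
Proof.
move=> su sp eta0 gapk.
have -> : q - p = shift_gap eta u p q + eta *: (u - p).
  by apply/rowP => i; rewrite !mxE; ring.
apply: le_trans (enormD _ _) _; rewrite enormZ gtr0_norm//.
by have := ler_wpM2l (ltW eta0) (enorm_simplex_sub su sp); lra.
Qed.

(** The coefficients 1 / eta^2 and (1 - eta) / eta^2 differ by 1 / eta, which gaps of size [k * eta]
    compensate. *)
Lemma doubled_gradients_close (A p : 'rV[R]_n1) (B q : 'rV[R]_n2) (eps eta k : R) :
  simplex p -> simplex q -> 0 < eta -> 0 <= eps ->
  enorm A <= k * eta -> enorm B <= k * eta ->
  enorm (row_mx (- (eta ^+ 2)^-1 *: A) (((1 - eta) / eta ^+ 2) *: B + (2 * eps) *: q)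
    - row_mx (- ((1 - eta) / eta ^+ 2) *: A - (2 * eps) *: p) ((eta ^+ 2)^-1 *: B))
  <= 2 * k + 4 * eps.
Proof.
move=> sp sq eta0 eps0 Ak Bk; have etaN0 : eta != 0 by rewrite gt_eqF.
rewrite opp_row_mx add_row_mx.
have -> : - (eta ^+ 2)^-1 *: A - (- ((1 - eta) / eta ^+ 2) *: A - (2 * eps) *: p)
    = - eta^-1 *: A + (2 * eps) *: p.
  by apply/rowP => i; rewrite !mxE; field.
have -> : ((1 - eta) / eta ^+ 2) *: B + (2 * eps) *: q - (eta ^+ 2)^-1 *: B
    = - eta^-1 *: B + (2 * eps) *: q.
  by apply/rowP => i; rewrite !mxE; field.
have bound n (v x : 'rV[R]_n) : enorm v <= k * eta -> simplex x ->
    enorm (- eta^-1 *: v + (2 * eps) *: x) <= k + 2 * eps.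
  move=> vk sx; apply: le_trans (enormD _ _) _; rewrite !enormZ normrN.
  have einv : 0 <= eta^-1 by rewrite invr_ge0 ltW.
  have eps2 : 0 <= 2 * eps by rewrite mulr_ge0.
  rewrite (ger0_norm einv) (ger0_norm eps2); apply: lerD; first by rewrite ler_pdivrMl// mulrC.
  by rewrite ler_piMr ?simplex_enorm_le1// mulr_ge0.
apply: le_trans (enorm_row_mx _ _) _.
by have := bound _ _ _ Ak sp; have := bound _ _ _ Bk sq; lra.
Qed.

(** The growth like k / eta is harmless: it will be multiplied by a distance of order [eta]. *)
Lemma doubled_gradient_bound (A p : 'rV[R]_n1) (B : 'rV[R]_n2) (eps eta k : R) :
  simplex p -> 0 < eta < 1 -> 0 <= eps ->
  enorm A <= k * eta -> enorm B <= k * eta ->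
  enorm (row_mx (- ((1 - eta) / eta ^+ 2) *: A - (2 * eps) *: p) ((eta ^+ 2)^-1 *: B))
  <= 2 * k / eta + 2 * eps.
Proof.
move=> sp /andP[eta0 eta1] eps0 Ak Bk.
have scaled n (v : 'rV[R]_n) : enorm v <= k * eta -> (eta ^+ 2)^-1 * enorm v <= k / eta.
  move=> vk; rewrite ler_pdivrMl ?exprn_gt0//.
  by apply: le_trans vk _; rewrite expr2 mulrA mulrAC mulfK ?gt_eqF// mulrC.
apply: le_trans (enorm_row_mx _ _) _.
have e2 : 0 <= (eta ^+ 2)^-1 by rewrite invr_ge0 sqr_ge0.
have eps2 : 0 <= 2 * eps by rewrite mulr_ge0.
have eta1' : 0 <= (1 - eta) / eta ^+ 2 by rewrite mulr_ge0//; lra.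
have := enormD (- ((1 - eta) / eta ^+ 2) *: A) (- ((2 * eps) *: p)).
rewrite enormN !enormZ normrN (ger0_norm e2) (ger0_norm eps2) (ger0_norm eta1').
have := scaled _ _ Ak; have := scaled _ _ Bk.
have : 2 * eps * enorm p <= 2 * eps.
  by rewrite ler_piMr ?simplex_enorm_le1// mulr_ge0.
have : 0 <= eta * ((eta ^+ 2)^-1 * enorm A).
  by rewrite !mulr_ge0 ?enorm_ge0// ltW.
by lra.
Qed.

(** The gradient mismatch contributes 2 k + 4 eps. The change of point contributes 6 eta (2 k / eta
    + 2 eps + 1), at most 12 k + 12 eps + 6 eta. *)
Lemma doubled_hamiltonians_close (D : set 'rV[R]_(n1 + n2))
    (H : 'rV[R]_(n1 + n2) -> 'rV[R]_(n1 + n2) -> R) (C eps eta k : R)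
    (u1 p1 q1 A : 'rV[R]_n1) (u2 p2 q2 B : 'rV[R]_n2) :
  (forall p g g', D p -> `|H p g - H p g'| <= C * enorm (g - g')) ->
  (forall p p' g, D p -> D p' ->
    `|H p g - H p' g| <= C * enorm (p - p') * (enorm g + 1)) ->
  D (row_mx p1 p2) -> D (row_mx q1 q2) ->
  simplex u1 -> simplex u2 -> simplex p1 -> simplex q2 ->
  0 < eta < 1 -> 0 <= eps -> k <= 1 ->
  shift_gap eta u1 p1 q1 = A -> shift_gap eta u2 q2 p2 = B ->
  enorm A <= k * eta -> enorm B <= k * eta ->
  H (row_mx q1 q2)
      (row_mx (- (eta ^+ 2)^-1 *: A) (((1 - eta) / eta ^+ 2) *: B + (2 * eps) *: q2))
    - H (row_mx p1 p2)
      (row_mx (- ((1 - eta) / eta ^+ 2) *: A - (2 * eps) *: p1) ((eta ^+ 2)^-1 *: B))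
  <= `|C| * (14 * k + 16 * eps + 6 * eta).
Proof.
move=> HC1 HC2 Dp Dq su1 su2 sp1 sq2 /[dup] eta01 /andP[eta0 eta1] eps0 k1.
move=> AE BE Ak Bk.
have := doubled_gradients_close sp1 sq2 eta0 eps0 Ak Bk.
have := doubled_gradient_bound sp1 eta01 eps0 Ak Bk.
rewrite -AE in Ak; rewrite -BE in Bk.
have qp : enorm (row_mx q1 q2 - row_mx p1 p2) <= 6 * eta.
  have k3 : (k + 2) * eta <= 3 * eta by rewrite ler_pM2r//; lra.
  rewrite opp_row_mx add_row_mx; apply: le_trans (enorm_row_mx _ _) _.
  have := enorm_gap su1 sp1 eta0 Ak; have := enorm_gap su2 sq2 eta0 Bk.
  by rewrite -(enormN (p2 - q2)) opprB; lra.
set G := row_mx (- ((1 - eta) / eta ^+ 2) *: A - _) _.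
set G' := row_mx (- (eta ^+ 2)^-1 *: A) _ => Gb GG.
have /ler_normlP[_ H1] := HC1 (row_mx q1 q2) G' G Dq.
have /ler_normlP[_ H2] := HC2 (row_mx q1 q2) (row_mx p1 p2) G Dq Dp.
have CK z : 0 <= z -> C * z <= `|C| * z by move=> z0; rewrite ler_wpM2r// ler_norm.
have H1' : C * enorm (G' - G) <= `|C| * (2 * k + 4 * eps).
  by apply: le_trans (CK _ (enorm_ge0 _)) _; exact: ler_wpM2l.
have H2' : C * enorm (row_mx q1 q2 - row_mx p1 p2) * (enorm G + 1)
    <= `|C| * (12 * k + 12 * eps + 6 * eta).
  rewrite -mulrA; apply: le_trans (CK _ _) _.
    by rewrite mulr_ge0 ?addr_ge0 ?enorm_ge0.
  apply: ler_wpM2l => //.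
  have : enorm (row_mx q1 q2 - row_mx p1 p2) * (enorm G + 1)
      <= 6 * eta * (2 * k / eta + 2 * eps + 1).
    by apply: ler_pM; rewrite ?addr_ge0 ?enorm_ge0 ?lerD2r.
  have -> : 6 * eta * (2 * k / eta + 2 * eps + 1)
      = 12 * k + 12 * (eta * eps) + 6 * eta by field; rewrite gt_eqF.
  have : eta * eps <= eps by rewrite ler_piMl// ltW.
  by lra.
lra.
Qed.

End hamiltonian_estimate.

(** * Estimates at the maximum from competitors without penalty *)

Section comparison.
Context {R : realType} {S1 S2 : finType}.
Local Notation E := 'rV[R]_(#|S1| + #|S2|).
Local Notation D := (Delta2 R S1 S2).
Variables (w1 w2 : E -> R) (eps eta : R).
Variables (u1 : 'rV[R]_#|S1|) (u2 : 'rV[R]_#|S2|).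
Hypotheses (su1 : simplex u1) (su2 : simplex u2).
Hypotheses (eta0 : 0 < eta) (eta1 : eta < 1).
Local Notation Phi := (doubled w1 w2 eps (eta ^+ 2) eta u1 u2).
Let toward n (u p : 'rV[R]_n) := (1 - eta) *: p + eta *: u.

Let simplex_toward n (u p : 'rV[R]_n) : simplex u -> simplex p -> simplex (toward u p).
Proof. by move=> su sp; apply: simplex_convex => //; rewrite !ltW. Qed.

Let gap_toward n (u p : 'rV[R]_n) : shift_gap eta u p (toward u p) = 0.
Proof. by apply/rowP => i; rewrite !mxE; ring. Qed.

Let sub_toward n (u p q : 'rV[R]_n) : q - toward u p = shift_gap eta u p q.
Proof. by apply/rowP => i; rewrite !mxE; ring. Qed.

Let enorm0 n : enorm (0 : 'rV[R]_n) = 0.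
Proof. by rewrite /enorm dot0l sqrtr0. Qed.

Lemma norm_sub_row_mxr (x : 'rV[R]_#|S1|) (y z : 'rV[R]_#|S2|) :
  `|row_mx x y - row_mx x z| <= enorm (y - z).
Proof.
rewrite opp_row_mx add_row_mx subrr; apply: le_trans (norm_le_enorm _) _.
by apply: le_trans (enorm_row_mx _ _) _; rewrite enorm0 add0r.
Qed.

Lemma norm_sub_row_mxl (x : 'rV[R]_#|S2|) (y z : 'rV[R]_#|S1|) :
  `|row_mx y x - row_mx z x| <= enorm (y - z).
Proof.
rewrite opp_row_mx add_row_mx subrr; apply: le_trans (norm_le_enorm _) _.
by apply: le_trans (enorm_row_mx _ _) _; rewrite enorm0 addr0.
Qed.

Variables (p1 q1 : 'rV[R]_#|S1|) (p2 q2 : 'rV[R]_#|S2|).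
Hypotheses (sp1 : simplex p1) (sp2 : simplex p2).
Hypotheses (sq1 : simplex q1) (sq2 : simplex q2).
Hypothesis Phi_max : forall p q, D p -> D q ->
  Phi p q <= Phi (row_mx p1 p2) (row_mx q1 q2).
Variables (rho om : R).
Hypotheses (uc1 : forall x y, D x -> D y -> `|x - y| < rho -> `|w1 x - w1 y| < om).
Hypotheses (uc2 : forall x y, D x -> D y -> `|x - y| < rho -> `|w2 x - w2 y| < om).
Let A := shift_gap eta u1 p1 q1.
Let B := shift_gap eta u2 q2 p2.

(** The competitor keeps p1 and q2 and closes both gaps by moving p2 and q1, so the [eps] terms
    cancel. *)
Let penalty_le : (dot A A + dot B B) / (2 * eta ^+ 2) <=
  (w1 (row_mx p1 p2) - w1 (row_mx p1 (toward u2 q2)))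
  + (w2 (row_mx (toward u1 p1) q2) - w2 (row_mx q1 q2)).
Proof.
have := Phi_max (Delta2_row_mx sp1 (simplex_toward su2 sq2))
  (Delta2_row_mx (simplex_toward su1 sp1) sq2).
rewrite /doubled !row_mxKl !row_mxKr !gap_toward !dot0l addr0 mul0r subr0.
by rewrite -/A -/B; lra.
Qed.

(** A bootstrap: boundedness of [w1] and [w2] gives gaps at most (8 b + 1) eta, below [rho]; uniform
    continuity then bounds the penalty by 2 om, which is at most k^2 / 2. *)
Lemma shift_gaps_small (b k : R) :
  (forall x, D x -> `|w1 x| <= b) -> (forall x, D x -> `|w2 x| <= b) ->
  (8 * b + 1) * eta < rho -> 0 <= k -> 4 * om <= k ^+ 2 ->
  enorm A <= k * eta /\ enorm B <= k * eta.
Proof.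
move=> w1b w2b brho k0 omk.
have bounds (a : R) : 0 <= a -> (dot A A + dot B B) / (2 * eta ^+ 2) <= a ^+ 2 / 2 ->
    enorm A <= a * eta /\ enorm B <= a * eta.
  move=> a0; rewrite ler_pdivrMr ?mulr_gt0 ?exprn_gt0//.
  have -> : a ^+ 2 / 2 * (2 * eta ^+ 2) = (a * eta) ^+ 2 by field.
  move=> AB; have := dot_ge0 A; have := dot_ge0 B => B0 A0.
  by split; apply: enorm_le; rewrite ?mulr_ge0 ?(ltW eta0)//; lra.
have Dp := Delta2_row_mx sp1 sp2; have Dq := Delta2_row_mx sq1 sq2.
have Dp' := Delta2_row_mx sp1 (simplex_toward su2 sq2).
have Dq' := Delta2_row_mx (simplex_toward su1 sp1) sq2.
have [Ab Bb] : enorm A <= (8 * b + 1) * eta /\ enorm B <= (8 * b + 1) * eta.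
  have b0 : 0 <= b by apply: le_trans (w1b _ Dp).
  apply: bounds; first by lra.
  apply: le_trans penalty_le _.
  move: (w1b _ Dp) (w1b _ Dp') (w2b _ Dq) (w2b _ Dq'); rewrite !ler_norml.
  move=> /andP[? ?] /andP[? ?] /andP[? ?] /andP[? ?].
  by have := sqr_ge0 b; lra.
apply: bounds => //; apply: le_trans penalty_le _.
have := @uc1 _ _ Dp Dp' _; have := @uc2 _ _ Dq' Dq _.
rewrite !ltr_norml => h2 h1.
have /h1/andP[_ ?] : `|row_mx p1 p2 - row_mx p1 (toward u2 q2)| < rho.
  apply: le_lt_trans brho; apply: le_trans (norm_sub_row_mxr _ _ _) _.
  by rewrite sub_toward.
have /h2/andP[_ ?] : `|row_mx (toward u1 p1) q2 - row_mx q1 q2| < rho.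
  apply: le_lt_trans brho; rewrite distrC.
  by apply: le_trans (norm_sub_row_mxl _ _ _) _; rewrite sub_toward.
lra.
Qed.

(** The competitor moves the second part of [x] for [w1] and the first for [w2], each by at most 2
    eta, so that no penalty remains; this costs 2 om, and the [eps] terms at the maximum are at most
    2 eps. *)
Lemma max_gap_le (x : E) : 0 <= eps -> 2 * eta < rho -> D x ->
  w1 x - w2 x <= w1 (row_mx p1 p2) - w2 (row_mx q1 q2) + 2 * om + 2 * eps.
Proof.
move=> eps0 etarho Dx; have [sx1 sx2] := Dx.
have Dy := Delta2_row_mx sx1 (simplex_toward su2 sx2).
have Dz := Delta2_row_mx (simplex_toward su1 sx1) sx2.
have := Phi_max Dy Dz.
rewrite /doubled !row_mxKl !row_mxKr !gap_toward !dot0l addr0 mul0r subr0 -/A -/B.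
have toward_near n (u p : 'rV[R]_n) : simplex u -> simplex p ->
    enorm (p - toward u p) < rho.
  move=> su sp; apply: le_lt_trans etarho.
  have -> : p - toward u p = eta *: (p - u) by apply/rowP => i; rewrite !mxE; ring.
  by rewrite enormZ gtr0_norm// mulrC ler_pM2r// enorm_simplex_sub.
have := @uc1 _ _ Dx Dy _; have := @uc2 _ _ Dx Dz _.
have nl := norm_sub_row_mxl (rsubmx x) (lsubmx x) (toward u1 (lsubmx x)).
have nr := norm_sub_row_mxr (lsubmx x) (rsubmx x) (toward u2 (rsubmx x)).
rewrite hsubmxK in nl nr.
move=> /(_ (le_lt_trans nl (toward_near _ _ _ su1 sx1))); rewrite ltr_norml => /andP[h1 _].
move=> /(_ (le_lt_trans nr (toward_near _ _ _ su2 sx2))); rewrite ltr_norml => /andP[_ h2].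
have e1 : eps * (dot p1 p1 + dot q2 q2) <= eps * 2.
  by apply: ler_wpM2l => //; have := simplex_dot_le1 sp1; have := simplex_dot_le1 sq2; lra.
have e2 : 0 <= eps * (dot (lsubmx x) (lsubmx x) + dot (rsubmx x) (rsubmx x)).
  by rewrite mulr_ge0 ?addr_ge0 ?dot_ge0.
have e3 : 0 <= (dot A A + dot B B) / (2 * eta ^+ 2).
  by apply: divr_ge0; rewrite ?addr_ge0 ?dot_ge0// mulr_ge0 ?sqr_ge0.
lra.
Qed.

End comparison.

(** * Choice of parameters and the contradiction *)

Theorem theorem8 (R : realType) (S1 S2 : finType) (r : R)
  (H : 'rV[R]_(#|S1| + #|S2|) -> 'rV[R]_(#|S1| + #|S2|) -> R)
  (w1 w2 : 'rV[R]_(#|S1| + #|S2|) -> R) :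
  0 < r ->
  (exists C : R,
    (forall p q q', Delta2 R S1 S2 p ->
       `|H p q - H p q'| <= C * enorm (q - q')) /\
    (forall p p' q, Delta2 R S1 S2 p -> Delta2 R S1 S2 p' ->
       `|H p q - H p' q| <= C * enorm (p - p') * (enorm q + 1))) ->
  {within Delta2 R S1 S2, continuous w1} ->
  viscosity_subsolution r H w1 ->
  {within Delta2 R S1 S2, continuous w2} ->
  viscosity_supersolution r H w2 ->
  forall p, Delta2 R S1 S2 p -> w1 p <= w2 p.
Proof.
move=> r0 [C [HC1 HC2]] cw1 sub1 cw2 sup2 x Dx; rewrite leNgt; apply/negP => w21.
have [[_ sx1] [_ sx2]] := Dx.
(* A point of the simplex forces a positive dimension, so the barycentre exists. *)
have pos n (z : 'rV[R]_n) : \sum_i z 0 i = 1 -> 0 < n%:R :> R.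
  case: n z => [|n] z; last by rewrite ltr0n.
  by rewrite big_ord0 => /esym/eqP; rewrite oner_eq0.
have n10 := pos _ _ sx1; have n20 := pos _ _ sx2.
have su n : 0 < n%:R :> R -> simplex (const_mx n%:R^-1 : 'rV[R]_n).
  move=> n0; split=> [i|]; first by rewrite mxE invr_ge0 ltW.
  under eq_bigr do rewrite mxE.
  by rewrite sumr_const card_ord -[_ *+ _]mulr_natr mulVf ?gt_eqF.
have su1 := su _ n10; have su2 := su _ n20.
set u1 := const_mx _ in su1; set u2 := const_mx _ in su2.
pose g := w1 x - w2 x; have g0 : 0 < g by rewrite subr_gt0.
pose K := `|C|; have K0 : 0 <= K by exact: normr_ge0.
(* The errors will sum to at most 36 K e from the Hamiltonians, with 36 = 14 + 16 + 6, and 4 r e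
   from the gap; 37 leaves room for strictness. *)
pose e := r * g / (37 * (r + K)).
have e0 : 0 < e by rewrite divr_gt0 ?mulr_gt0// ltr_wpDr.
have eE : 36 * (r + K) * e < r * g.
  have rK : 0 < r + K by rewrite ltr_wpDr.
  have -> : r * g = 37 * (r + K) * e by rewrite /e; field; rewrite gt_eqF.
  by rewrite ltr_pM2r// ltr_pM2r// ltr_nat.
pose k := Num.min (Num.min e 1) (Num.min (#|S1|%:R^-1 / 2) (#|S2|%:R^-1 / 2)).
have k0 : 0 < k by rewrite !lt_min e0 ltr01 !divr_gt0 ?invr_gt0.
have [ke k1 kn1 kn2] : [/\ k <= e, k <= 1, k <= #|S1|%:R^-1 / 2 & k <= #|S2|%:R^-1 / 2].
  by split; rewrite /k !ge_min lexx ?orbT.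
pose om := Num.min e (k ^+ 2 / 4).
have om0 : 0 < om by rewrite lt_min e0 divr_gt0 ?exprn_gt0.
have [ome omk] : om <= e /\ om <= k ^+ 2 / 4.
  by split; rewrite /om !ge_min lexx ?orbT.
have [b1 b10 w1b] := within_continuous_bounded compact_Delta2 cw1.
have [b2 b20 w2b] := within_continuous_bounded compact_Delta2 cw2.
have [rho1 rho10 uc1] := within_uniformly_continuous compact_Delta2 cw1 om0.
have [rho2 rho20 uc2] := within_uniformly_continuous compact_Delta2 cw2 om0.
pose b := b1 + b2; pose rho := Num.min rho1 rho2.
have rho0 : 0 < rho by rewrite lt_min rho10.
have {}w1b y : Delta2 R S1 S2 y -> `|w1 y| <= b.
  by move=> /w1b /le_trans; apply; rewrite lerDl.
have {}w2b y : Delta2 R S1 S2 y -> `|w2 y| <= b.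
  by move=> /w2b /le_trans; apply; rewrite lerDr.
have {}uc1 y z : Delta2 R S1 S2 y -> Delta2 R S1 S2 z -> `|y - z| < rho ->
    `|w1 y - w1 z| < om.
  by move=> Dy Dz; rewrite lt_min => /andP[? _]; exact: uc1.
have {}uc2 y z : Delta2 R S1 S2 y -> Delta2 R S1 S2 z -> `|y - z| < rho ->
    `|w2 y - w2 z| < om.
  by move=> Dy Dz; rewrite lt_min => /andP[_ ?]; exact: uc2.
have b0 : 0 <= b by rewrite addr_ge0.
have b2' : 0 < 8 * b + 3 by lra.
(* The divisor 8 b + 3 makes both (8 b + 1) eta and 2 eta smaller than [rho]. *)
pose eta := Num.min (Num.min e (1 / 2)) (rho / (8 * b + 3)).
have eta0 : 0 < eta by rewrite !lt_min e0 !divr_gt0.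
have [etae eta2 etarho] : [/\ eta <= e, eta <= 1 / 2 & eta * (8 * b + 3) <= rho].
  split; rewrite /eta -?ler_pdivlMr// !ge_min lexx ?orbT//.
have eta1 : eta < 1 by lra.
have [p [q [Dp Dq pqmax]]] := doubled_has_max cw1 cw2 e (eta ^+ 2) eta u1 u2
  (ex_intro _ x Dx).
have [p1 [p2 pE]] : exists p1 p2, p = row_mx p1 p2.
  by exists (lsubmx p), (rsubmx p); rewrite hsubmxK.
have [q1 [q2 qE]] : exists q1 q2, q = row_mx q1 q2.
  by exists (lsubmx q), (rsubmx q); rewrite hsubmxK.
move: Dp Dq pqmax; rewrite {}pE {}qE => Dp Dq pqmax.
have [sp1 sp2] := Dp; have [sq1 sq2] := Dq.
rewrite !row_mxKl !row_mxKr in sp1 sp2 sq1 sq2.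
have be0 : 0 <= b * eta by rewrite mulr_ge0// ltW.
have etarho1 : (8 * b + 1) * eta < rho by lra.
have etarho2 : 2 * eta < rho by lra.
have omk4 : 4 * om <= k ^+ 2 by lra.
have [Ak Bk] := shift_gaps_small su1 su2 eta0 eta1 sp1 sp2 sq1 sq2 pqmax uc1 uc2
  w1b w2b etarho1 (ltW k0) omk4.
have := max_gap_le su1 su2 eta0 eta1 sp1 sq2 pqmax uc1 uc2
  (ltW e0) etarho2 Dx.
rewrite -/g => gap_pq.
(* The barycentre contributes eta / n to each coordinate and the gap removes at most k eta, which is
   at most half of it. *)
have interior n (u s t : 'rV[R]_n) i : (forall j, u 0 j = n%:R^-1) ->
    k <= n%:R^-1 / 2 -> simplex s -> enorm (shift_gap eta u s t) <= k * eta ->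
    k * eta <= t 0 i.
  move=> uE kn [s0 _] /(le_trans (coord_le_enorm _ i)).
  rewrite !mxE uE ler_norml => /andP[h _].
  have : 0 <= (1 - eta) * s 0 i by rewrite mulr_ge0// subr_ge0 ltW.
  have : k * eta <= n%:R^-1 / 2 * eta by rewrite ler_pM2r.
  by lra.
have c0 : 0 < k * eta by rewrite mulr_gt0.
have cq1 i : k * eta <= q1 0 i.
  by apply: interior kn1 sp1 Ak => j; rewrite mxE.
have cp2 i : k * eta <= p2 0 i.
  by apply: interior kn2 sq2 Bk => j; rewrite mxE.
have eta01 : 0 < eta < 1 by rewrite eta0.
have eta20 : 0 < eta ^+ 2 by rewrite exprn_gt0.
have := subsolution_at_max sub1 sup2 cw2 e0 eta20 eta01 sp1 sp2 sq1 sq2 pqmax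
  c0 cq1 erefl erefl.
have := supersolution_at_max sub1 cw1 sup2 e0 eta20 eta01 sp1 sp2 sq1 sq2 pqmax
  c0 cp2 erefl erefl.
have := doubled_hamiltonians_close HC1 HC2 Dp Dq su1 su2 sp1 sq2 eta01 (ltW e0) k1
  erefl erefl Ak Bk.
move=> gapH sup_pq sub_pq.
have K36 : K * (14 * k + 16 * e + 6 * eta) <= K * (36 * e).
  by apply: ler_wpM2l => //; lra.
have rw : r * g <= r * (w1 (row_mx p1 p2) - w2 (row_mx q1 q2) + 2 * om + 2 * e).
  by rewrite ler_pM2l.
have rom : r * om <= r * e by rewrite ler_pM2l.
have re : 0 < r * e by exact: mulr_gt0.
(* The two inequalities bound r (w1 - w2) at the maximum by 36 K e, whereas [rw] and [rom] make it
   at least r g - 4 r e; this contradicts [eE]. *)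
move: gapH sup_pq sub_pq K36 rw rom re eE gap_pq; clear; rewrite -/K; lra.
Qed.
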